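(* Consider a system of exponential-Diophantine equations $$\sum_{i=1}^{s} P_{ij}(n_1,\dots,n_t)\, b_{ij0}\,a_{ij1}^{n_1}\,b_{ij1}\cdots a_{ijt}^{n_t}\,b_{ijt}=0,$$ where the $b_{ijk},a_{ijk}$ are constants from a matrix ring of characteristic $p$, the $P_{ij}$ are polynomials, and $n_1,\dots,n_t$ are indeterminates. The set of words (over an alphabet of $p^t$ symbols) corresponding to solutions of the system is a regular language, i.e. it is recognizable by a finite automaton. There exists an effective algorithm which calculates this language.
   Context: The index $j$ numbers the equations of the system. The matrix ring is a ring of matrices over a field of positive characteristic $p$. A solution is a tuple $(n_1,\dots,n_t)\in\mathbb{N}^t$ satisfying all the equations, where $\mathbb{N}$ is the set of natural numbers (including $0$). Words corresponding to solutions: the alphabet consists of all $t$-tuples of figures $0,1,\dots,p-1$, so it has $p^t$ symbols. To a solution $(n_1,\dots,n_t)$ one attaches the sequence of tuples of figures $\langle n_1^{k},\dots,n_t^{k}\rangle,\dots,\langle n_1^{0},\dots,n_t^{0}\rangle$, where $n_i^{l}$ is the $l$-th digit in the $p$-adic (radix $p$) representation of $n_i$; the tuples are regarded as letters and the sequence as a word. Words are written from right to left, so the tuple of lowest digits is the rightmost letter. Formally, let $\phi$ be the map sending a finite word $u$ over this alphabet to the $t$-tuple of numbers whose $i$-th member is the number written with radix $p$ by the $i$-th components of the letters of $u$; a word $u$ is a word-solution if $\phi(u)$ is a solution. A finite automaton is a finite oriented graph in which some vertex is declared initial, some vertices are declared final, and each edge is marked by a symbol of some finite alphabet. A regular language is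 the set of words which may be read at the edges of some finite automaton along a path from the initial vertex to a final one. *)

(* Defs.v *)
From HB Require Import structures.
From mathcomp Require Import all_boot all_algebra.
From mathcomp Require Export mpoly.

Set Implicit Arguments.
Unset Strict Implicit.
Unset Printing Implicit Defensive.

Import GRing.Theory.
Local Open Scope ring_scope.

(* Indices are shifted to start at 0: [P i j], [a i j k], [b i j k] stand for
   P_{ij}, a_{ij(k+1)}, b_{ijk} of
     sum_i P_ij(n) b_ij0 a_ij1^{n_1} b_ij1 ... a_ijt^{n_t} b_ijt = 0,
   with i < s numbering the summands and j < r the equations. *)
Record expsys (K : fieldType) (d t s r : nat) := ExpSys {
  P : 'I_s -> 'I_r -> {mpoly K[t]};
  b : 'I_s -> 'I_r -> 'I_t.+1 -> 'M[K]_d.+1;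
  a : 'I_s -> 'I_r -> 'I_t -> 'M[K]_d.+1
}.

Definition is_solution (K : fieldType) (d t s r : nat)
    (S : expsys K d t s r) (n : 'I_t -> nat) : Prop :=
  forall j : 'I_r,
    \sum_(i < s) (P S i j).@[fun k => (n k)%:R] *:
      (b S i j ord0 *
       \prod_(k < t) (a S i j k ^+ n k * b S i j (lift ord0 k))) = 0.

Definition letter (p t : nat) := {ffun 'I_t -> 'I_p}.

(* The leftmost letter carries the highest digits; leading zeros are allowed. *)
Definition phi (p t : nat) (u : seq (letter p t)) : 'I_t -> nat :=
  fun k => foldl (fun n (x : letter p t) => (p * n + x k)%N) 0%N u.

Definition word_solution (p : nat) (K : fieldType) (d t s r : nat)
    (S : expsys K d t s r) (u : seq (letter p t)) : Prop :=
  is_solution S (phi u).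

(* [(x, l, y) \in edges M] is an edge from x to y marked by l. *)
Record automaton (A : eqType) := Automaton {
  nstates : nat;
  init : 'I_nstates;
  final : seq 'I_nstates;
  edges : seq ('I_nstates * A * 'I_nstates)
}.

Fixpoint reads (A : eqType) (M : automaton A) (x : 'I_(nstates M)) (u : seq A)
    (y : 'I_(nstates M)) : Prop :=
  if u is l :: u' then exists2 z, (x, l, z) \in edges M & reads z u' y
  else x = y.

Definition recognizes (A : eqType) (M : automaton A) (L : seq A -> Prop) : Prop :=
  forall u, L u <-> exists2 y, y \in final M & reads (init M) u y.

Definition regular (A : eqType) (L : seq A -> Prop) : Prop :=
  exists M : automaton A, recognizes M L.

(* The model of computation: partial recursive functions on binary trees.
   They are built from projections and constructors by composition, case
   distinction ([Leaf] is false), structural recursion and while loops (as in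
   Jones's WHILE language).  A program diverges on x when [computes f x y]
   holds for no y. *)
Inductive tree := Leaf | Node of tree & tree.

Inductive prog :=
  | PId
  | PLeaf
  | PNode of prog & prog
  | PLeft
  | PRight
  | PComp of prog & prog
  | PIf of prog & prog & prog
  | PRec of prog & prog
  | PWhile of prog & prog.

Inductive computes : prog -> tree -> tree -> Prop :=
  | CId x : computes PId x x
  | CLeaf x : computes PLeaf x Leaf
  | CNode f g x y z :
      computes f x y -> computes g x z -> computes (PNode f g) x (Node y z)
  | CLeft x y : computes PLeft (Node x y) x
  | CLeftLeaf : computes PLeft Leaf Leaf
  | CRight x y : computes PRight (Node x y) y
  | CRightLeaf : computes PRight Leaf Leaf
  | CComp f g x y z :
      computes g x y -> computes f y z -> computes (PComp f g) x z
  | CIfTrue c f g x u v y :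
      computes c x (Node u v) -> computes f x y -> computes (PIf c f g) x y
  | CIfFalse c f g x y :
      computes c x Leaf -> computes g x y -> computes (PIf c f g) x y
  | CRecLeaf f g x y :
      computes f x y -> computes (PRec f g) (Node x Leaf) y
  | CRecNode f g x l r yl yr y :
      computes (PRec f g) (Node x l) yl ->
      computes (PRec f g) (Node x r) yr ->
      computes g (Node x (Node (Node l r) (Node yl yr))) y ->
      computes (PRec f g) (Node x (Node l r)) y
  | CWhileStop c f x : computes c x Leaf -> computes (PWhile c f) x x
  | CWhileStep c f x u v y z :
      computes c x (Node u v) -> computes f x y -> computes (PWhile c f) y z ->
      computes (PWhile c f) x z.

Definition enc_nat (n : nat) : tree := iter n (Node Leaf) Leaf.

Definition enc_seq (T : Type) (e : T -> tree) (l : seq T) : tree :=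
  foldr (fun x => Node (e x)) Leaf l.

Definition enc_fun (T : Type) (n : nat) (e : T -> tree) (f : 'I_n -> T) : tree :=
  enc_seq e [seq f i | i <- enum 'I_n].

Definition enc_letter (p t : nat) (x : letter p t) : tree :=
  enc_fun (fun i : 'I_p => enc_nat i) x.

Definition enc_automaton (p t : nat) (M : automaton (letter p t)) : tree :=
  Node (enc_nat (nstates M))
    (Node (enc_nat (init M))
      (Node (enc_seq (fun x : 'I_(nstates M) => enc_nat x) (final M))
        (enc_seq (fun e : 'I_(nstates M) * letter p t * 'I_(nstates M) =>
            Node (enc_nat e.1.1) (Node (enc_letter e.1.2) (enc_nat e.2)))
          (edges M)))).

(* To be the input of an algorithm, the constants of a system must be given
   finitely.  They generate a field F_p(c_0, ..., c_{m-1}), which is determined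
   by generators of the ideal of algebraic relations between the c_i
   (finitely many suffice, by Hilbert's basis theorem); each constant is given
   as a fraction of two polynomials in the c_i. *)
Definition frac (p m : nat) := ({mpoly 'F_p[m]} * {mpoly 'F_p[m]})%type.

(* [Pdesc D i j] lists the monomials of P_{ij} with their coefficients. *)
Record sysdesc (p m d t s r : nat) := SysDesc {
  relations : seq {mpoly 'F_p[m]};
  Pdesc : 'I_s -> 'I_r -> seq ('X_{1..t} * frac p m);
  bdesc : 'I_s -> 'I_r -> 'I_t.+1 -> 'M[frac p m]_d.+1;
  adesc : 'I_s -> 'I_r -> 'I_t -> 'M[frac p m]_d.+1
}.

(* The map 'F_p -> K sending x to (x : nat)%:R is the canonical embedding when K
   has characteristic p. *)
Definition evalF (p m : nat) (K : fieldType) (c : 'I_m -> K)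
    (f : {mpoly 'F_p[m]}) : K :=
  mmap (fun x : 'F_p => (x : nat)%:R) c f.

Definition in_ideal (R : comNzRingType) (m : nat) (g : seq {mpoly R[m]})
    (f : {mpoly R[m]}) : Prop :=
  exists q : nat -> {mpoly R[m]}, f = \sum_(i < size g) q i * g`_i.

Definition all_relations (p m : nat) (K : fieldType) (c : 'I_m -> K)
    (g : seq {mpoly 'F_p[m]}) : Prop :=
  forall f : {mpoly 'F_p[m]}, evalF c f = 0 <-> in_ideal g f.

Definition denotes (p m : nat) (K : fieldType) (c : 'I_m -> K)
    (q : frac p m) (x : K) : Prop :=
  evalF c q.2 != 0 /\ x = evalF c q.1 / evalF c q.2.

Definition poly_denotes (p m t : nat) (K : fieldType) (c : 'I_m -> K)
    (l : seq ('X_{1..t} * frac p m)) (f : {mpoly K[t]}) : Prop :=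
  (forall u, u \in l -> evalF c u.2.2 != 0) /\
  f = \sum_(u <- l) (evalF c u.2.1 / evalF c u.2.2) *: 'X_[u.1].

Definition describes (p m d t s r : nat) (K : fieldType) (c : 'I_m -> K)
    (D : sysdesc p m d t s r) (S : expsys K d t s r) : Prop :=
  [/\ all_relations c (relations D),
      forall i j, poly_denotes c (Pdesc D i j) (P S i j),
      forall i j k x y, denotes c (bdesc D i j k x y) (b S i j k x y) &
      forall i j k x y, denotes c (adesc D i j k x y) (a S i j k x y)].

Definition enc_monom (n : nat) (u : 'X_{1..n}) : tree :=
  enc_fun enc_nat (fun i : 'I_n => u i).

Definition enc_mpoly (p m : nat) (f : {mpoly 'F_p[m]}) : tree :=
  enc_seq (fun u => Node (enc_monom u) (enc_nat f@_u)) (msupp f).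

Definition enc_frac (p m : nat) (q : frac p m) : tree :=
  Node (enc_mpoly q.1) (enc_mpoly q.2).

Definition enc_mx (p m d : nat) (A : 'M[frac p m]_d) : tree :=
  enc_fun (enc_fun (@enc_frac p m)) (fun x y => A x y).

Definition enc_sysdesc (p m d t s r : nat) (D : sysdesc p m d t s r) : tree :=
  Node (enc_seq enc_nat [:: p; m; d; t; s; r])
    (Node (enc_seq (@enc_mpoly p m) (relations D))
      (Node (enc_fun (enc_fun (enc_seq (fun u : 'X_{1..t} * frac p m =>
                Node (enc_monom u.1) (enc_frac u.2)))) (Pdesc D))
        (Node (enc_fun (enc_fun (enc_fun (@enc_mx p m d.+1))) (bdesc D))
          (enc_fun (enc_fun (enc_fun (@enc_mx p m d.+1))) (adesc D))))).

(* Main.v *)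
Require Import Defs.
From mathcomp Require Import all_boot all_algebra.
From HB Require Import structures.
From mathcomp Require Import closed_field zify ring ssrcomplements.
From Stdlib Require Import Classical.

(** Reading a letter at the right end of a word replaces the exponents n by
    p n + a, and in characteristic p this can be undone by taking p-th roots.

    The constants of a system lie in the field of fractions of F_p[X]/I, where
    I is the ideal of polynomials that vanish at the constants c.  By
    Cayley-Hamilton, the entries of the left hand sides are values at c of
    forms f = sum_l f_l Y_l(n), where the f_l are polynomials in X and the
    Y_l(n) are products of coefficients of powers of a variable modulo
    characteristic polynomials; the polynomials P_ij only see n modulo p, that
    is, the last letter.  As the Frobenius map is a ring morphism, Y(p n + a) is
    a combination of the p-th powers of the Y_l(n) ([xpow_Frobenius],
    [power_coef_rec]).

    Whether sum_l g_l Y_l(n)^p vanishes at c is decided by a form [root_form w]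
    with root_form w (s^p f) = s root_form w f that maps I into I but not
    everything into I: g vanishes at c if and only if all root_form w (X^e g)
    do ([zero_test]).  Such a w consists of minors of the matrix of components
    of members of I over p-th powers, because this matrix is singular at c
    ([root_form_exists]); so its degree is bounded in terms of generators of I.
    Hence the zero test for a form at p n + a is the conjunction of zero tests
    at n for finitely many other forms, and since taking p-th roots divides
    degrees by p, all these forms have degrees below an explicit bound
    ([form_digitP], [degree_boundP]).  The set of the forms of bounded degree
    that vanish after a word is therefore the state of a deterministic
    automaton that reads the highest digits first ([finite_state]).

    The algorithm does not compute these states; it only uses the bound N on
    their number.  By Myhill and Nerode, an automaton for the language can be
    read off from the membership of all words of length at most 2 N^2 + 1
    ([test_automaton_recognizes]).  Membership of a word means that certain
    polynomials lie in I.  A search settles this: if f is in I, a combination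
    of the generators shows it; if it is not, then f does not vanish at some
    point over a finite field at which I does ([finite_point]), and f does not
    become a member when the polynomials X_i^(p^N) - X_i are added to I
    ([settled_eventually]).  The search is written with primitive recursive
    functions on lists of numbers and a single unbounded search, and these are
    programs on trees ([computable_search]). *)

Set Implicit Arguments.
Unset Strict Implicit.
Unset Printing Implicit Defensive.

Import GRing.Theory.

(** * Computability of functions on encoded data *)

(** On numbers, pairs and lists the instances below agree with the encodings of
    descriptions and automata. *)
Class Enc (T : Type) := enc : T -> tree.

#[local] Instance Enc_unit : Enc unit := fun=> Leaf.
#[local] Instance Enc_nat : Enc nat := enc_nat.
#[local] Instance Enc_bool : Enc bool := fun b => if b then Node Leaf Leaf else Leaf.
#[local] Instance Enc_prod A B (_ : Enc A) (_ : Enc B) : Enc (A * B) :=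
  fun x => Node (enc x.1) (enc x.2).
#[local] Instance Enc_seq A (_ : Enc A) : Enc (seq A) := enc_seq enc.

Definition computable {A B : Type} {EA : Enc A} {EB : Enc B} (f : A -> B) : Prop :=
  exists P : prog, forall x, computes P (enc x) (enc (f x)).

Section Basic.
Context {E A B C : Type} {EE : Enc E} {EA : Enc A} {EB : Enc B} {EC : Enc C}.

Lemma computable_ext (f g : A -> B) : f =1 g -> computable f -> computable g.
Proof. by move=> fg [P HP]; exists P => x; rewrite -fg. Qed.

Lemma computable_id : computable (fun x : A => x).
Proof. by exists PId => x; constructor. Qed.

Lemma computable_app (f : A -> B) (g : E -> A) :
  computable f -> computable g -> computable (fun e => f (g e)).
Proof. by move=> [P HP] [Q HQ]; exists (PComp P Q) => x; econstructor. Qed.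

Lemma computable_const (b : B) : computable (fun _ : E => b).
Proof.
suff aux y : exists P, forall x, computes P x y.
  by have [P HP] := aux (enc b); exists P => x.
elim: y => [|u [P HP] v [Q HQ]]; first by exists PLeaf => x; constructor.
by exists (PNode P Q) => x; constructor.
Qed.

Lemma computable_pair (f : E -> A) (g : E -> B) :
  computable f -> computable g -> computable (fun e => (f e, g e)).
Proof. by move=> [P HP] [Q HQ]; exists (PNode P Q) => x; constructor. Qed.

Lemma computable_fst (f : E -> A * B) : computable f -> computable (fun e => (f e).1).
Proof.
move=> [P HP]; exists (PComp PLeft P) => x.
by apply: CComp (HP x) _; constructor.
Qed.

Lemma computable_snd (f : E -> A * B) : computable f -> computable (fun e => (f e).2).
Proof.
move=> [P HP]; exists (PComp PRight P) => x.
by apply: CComp (HP x) _; constructor.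
Qed.

Lemma computable_if (b : E -> bool) (f g : E -> A) :
  computable b -> computable f -> computable g ->
  computable (fun e => if b e then f e else g e).
Proof.
move=> [P HP] [Q HQ] [R HR]; exists (PIf P Q R) => x.
by case Hb: (b x); move: (HP x); rewrite Hb => HPx;
  [apply: CIfTrue HPx _ | apply: CIfFalse HPx _].
Qed.

Lemma computable_cons (f : E -> A) (g : E -> seq A) :
  computable f -> computable g -> computable (fun e => f e :: g e).
Proof. by move=> [P HP] [Q HQ]; exists (PNode P Q) => x; constructor. Qed.

Lemma computable_behead (f : E -> seq A) :
  computable f -> computable (fun e => behead (f e)).
Proof.
move=> [P HP]; exists (PComp PRight P) => x; apply: CComp (HP x) _.
by case: (f x) => [|a l] /=; constructor.
Qed.

Lemma computable_head (d : E -> A) (f : E -> seq A) :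
  computable d -> computable f -> computable (fun e => head (d e) (f e)).
Proof.
move=> [P HP] [Q HQ]; exists (PIf Q (PComp PLeft Q) P) => x.
move: (HQ x); case: (f x) => [|a l] HQx; first exact: CIfFalse.
by apply: CIfTrue (HQx) _; apply: CComp HQx _; constructor.
Qed.

(** A list is consumed by a while loop on the state (environment,
    accumulator, remaining items).  Structural recursion would also run the
    body on the subtrees of the items, where nothing is known about it. *)
Lemma computable_foldl (f : E -> B -> A -> B) (b : E -> B) (l : E -> seq A) :
  computable (fun z : E * (B * A) => f z.1 z.2.1 z.2.2) ->
  computable b -> computable l ->
  computable (fun e => foldl (f e) (b e) (l e)).
Proof.
move=> [F HF] [P HP] [Q HQ].
pose step := PNode PLeft
  (PNode (PComp F (PNode PLeft (PNode (PComp PLeft PRight)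
                                      (PComp PLeft (PComp PRight PRight)))))
         (PComp PRight (PComp PRight PRight))).
exists (PComp (PComp PLeft PRight)
         (PComp (PWhile (PComp PRight PRight) step) (PNode PId (PNode P Q)))).
move=> x; apply: (@CComp _ _ _ (Node (enc x) (Node (enc (foldl (f x) (b x) (l x))) Leaf))).
  apply: (@CComp _ _ _ (Node (enc x) (Node (enc (b x)) (enc (l x))))).
    by repeat constructor.
  elim: (l x) (b x) => [|a s IH] acc /=.
    by apply: CWhileStop; repeat econstructor.
  apply: CWhileStep (IH _); first by repeat econstructor.
  constructor; first exact: CLeft.
  constructor; last by repeat econstructor.
  apply: (@CComp _ _ _ (enc (x, (acc, a)))); last exact: HF.
  by repeat econstructor.
by repeat econstructor.
Qed.

End Basic.

Lemma computable_app2 (E A B C : Type) (EE : Enc E) (EA : Enc A) (EB : Enc B) (EC : Enc C)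
    (f : A -> B -> C) (g : E -> A) (h : E -> B) :
  computable (fun z : A * B => f z.1 z.2) -> computable g -> computable h ->
  computable (fun e => f (g e) (h e)).
Proof.
by move=> Hf Hg Hh; apply: (computable_app Hf (computable_pair Hg Hh)).
Qed.

(** Unbounded search for the least stage at which a test succeeds; this is the
    only source of partiality. *)
Lemma computable_search (E A : Type) (EE : Enc E) (EA : Enc A)
    (test : E -> nat -> bool) (out : E -> nat -> A) :
  computable (fun z : E * nat => test z.1 z.2) ->
  computable (fun z : E * nat => out z.1 z.2) ->
  exists P : prog, forall e, (exists n, test e n) ->
    exists2 n, test e n & computes P (enc e) (enc (out e n)).
Proof.
move=> [T HT] [Q HQ].
pose loop := PWhile (PIf T PLeaf (PNode PLeaf PLeaf)) (PNode PLeft (PNode PLeaf PRight)).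
exists (PComp Q (PComp loop (PNode PId PLeaf))) => e ex.
case: (ex_minnP ex) => n Hn Hmin; exists n => //.
apply: (CComp _ (HQ (e, n))); apply: (@CComp _ _ _ (enc (e, 0))).
  by repeat constructor.
have Hloop k i : (forall j, j < k -> ~~ test e (j + i)) -> test e (k + i) ->
    computes loop (enc (e, i)) (enc (e, k + i)).
  elim: k i => [|k IH] i Hlt Hi; move: (HT (e, i)) => /= HTi.
    by apply: CWhileStop; move: HTi; rewrite Hi => HTi; apply: CIfTrue HTi _; constructor.
  have := Hlt 0 isT; rewrite add0n => /negbTE Hf; rewrite Hf in HTi.
  apply: (@CWhileStep _ _ _ Leaf Leaf (enc (e, i.+1))).
  - by apply: CIfFalse HTi _; repeat constructor.
  - by repeat constructor.
  - rewrite addSnnS; apply: IH; last by rewrite -addSnnS.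
    by move=> j jk; rewrite -addSnnS; apply: Hlt.
have := Hloop n 0; rewrite addn0; apply=> // j.
by rewrite addn0; apply: contraL => /Hmin; rewrite -leqNgt.
Qed.

Section Arithmetic.
Context {E A B : Type} {EE : Enc E} {EA : Enc A} {EB : Enc B}.

Lemma computable_iter (n : E -> nat) (f : E -> A -> A) (b : E -> A) :
  computable (fun z : E * A => f z.1 z.2) -> computable n -> computable b ->
  computable (fun e => iter (n e) (f e) (b e)).
Proof.
move=> Hf Hn Hb.
have Hu : computable (fun e => nseq (n e) tt).
  have [P HP] := Hn; exists P => x; move: (HP x); congr computes.
  have enc_nseq k : enc_nat k = enc_seq enc (nseq k tt) by elim: k => //= k ->.
  exact: enc_nseq.
apply: (computable_ext _ (computable_foldl (f := fun e acc (_ : unit) => f e acc) _ Hb Hu)).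
  move=> x; elim: (n x) (b x) => [|k IH] c //=.
  by rewrite IH -iterSr.
have Hz : computable (fun z : E * (A * unit) => (z.1, z.2.1)).
  apply: computable_pair; first exact: computable_fst computable_id.
  exact: computable_fst (computable_snd computable_id).
exact: (computable_app (f := fun z : E * A => f z.1 z.2) Hf Hz).
Qed.

Lemma computable_S (f : E -> nat) : computable f -> computable (fun e => (f e).+1).
Proof.
by move=> [P HP]; exists (PNode PLeaf P) => x; constructor; first constructor.
Qed.

Lemma computable_pred (f : E -> nat) : computable f -> computable (fun e => (f e).-1).
Proof.
move=> [P HP]; exists (PComp PRight P) => x; apply: CComp (HP x) _.
by case: (f x) => [|n]; constructor.
Qed.

Lemma computable_eq0 (f : E -> nat) : computable f -> computable (fun e => f e == 0).
Proof.
move=> [P HP]; exists (PIf P PLeaf (PNode PLeaf PLeaf)) => x.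
move: (HP x); case: (f x) => [|n] HPx; first by apply: CIfFalse HPx _; repeat constructor.
by apply: CIfTrue HPx _; constructor.
Qed.

End Arithmetic.

(** Extended whenever further operations are known to be computable. *)
Ltac computable_hook := fail.

(** Decides computability by the outermost operation of the body. *)
Ltac computable_step :=
  lazymatch goal with
  | |- computable (fun _ => ?c) => apply: computable_const
  | |- computable (fun x => x) => apply: computable_id
  | |- computable fst => exact: (computable_fst computable_id)
  | |- computable snd => exact: (computable_snd computable_id)
  | |- computable (fun _ => (_, _)) => apply: computable_pair
  | |- computable (fun _ => fst _) => apply: computable_fst
  | |- computable (fun _ => snd _) => apply: computable_snd
  | |- computable (fun _ => if _ then _ else _) => apply: computable_if
  | |- computable (fun _ => _ :: _) => apply: computable_cons
  | |- computable (fun _ => behead _) => apply: computable_behead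
  | |- computable (fun _ => head _ _) => apply: computable_head
  | |- computable (fun _ => foldl _ _ _) => apply: computable_foldl
  | |- computable (fun _ => iter _ _ _) => apply: computable_iter
  | |- computable (fun _ => S _) => apply: computable_S
  | |- computable (fun _ => predn _) => apply: computable_pred
  | |- computable (fun _ => _ == 0) => apply: computable_eq0
  | H : computable ?f |- computable (fun e => ?f (@?g e)) =>
      apply: (computable_app H)
  | |- computable (fun e => ?f (@?g e) (@?h e)) =>
      first [ apply: (@computable_app2 _ _ _ _ _ _ _ _ f g h); [assumption | |]
            | computable_hook ]
  | _ => computable_hook
  end.

Ltac computability := repeat first [assumption | progress cbv beta | computable_step].

Section DerivedArithmetic.
Context {E : Type} {EE : Enc E}.
Variables f g : E -> nat.
Hypotheses (Hf : computable f) (Hg : computable g).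

Lemma computable_addn : computable (fun e => f e + g e).
Proof.
apply: (@computable_ext _ _ _ _ (fun e => iter (f e) S (g e))).
  by move=> e; elim: (f e) => //= n ->.
by computability.
Qed.

Lemma computable_subn : computable (fun e => f e - g e).
Proof.
apply: (@computable_ext _ _ _ _ (fun e => iter (g e) predn (f e))).
  by move=> e; elim: (g e) => [|n /= ->]; rewrite ?subn0 // subnS.
by computability.
Qed.

Lemma computable_muln : computable (fun e => f e * g e).
Proof.
apply: (@computable_ext _ _ _ _ (fun e => iter (f e) (addn (g e)) 0)).
  by move=> e; rewrite iter_addn_0 mulnC.
apply: computable_iter => //; last exact: computable_const.
apply: (@computable_ext _ _ _ _ (fun z => iter (g z.1) S z.2)).
  by move=> e; elim: (g e.1) => //= n ->.
by computability.
Qed.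

End DerivedArithmetic.

Section DerivedArithmetic2.
Context {E : Type} {EE : Enc E}.
Variables f g : E -> nat.
Hypotheses (Hf : computable f) (Hg : computable g).

Lemma computable_expn : computable (fun e => f e ^ g e).
Proof.
apply: (@computable_ext _ _ _ _ (fun e => iter (g e) (muln (f e)) 1)).
  by move=> e; elim: (g e) => [|n /= ->]; rewrite ?expn0 ?expnS.
apply: computable_iter => //; last exact: computable_const.
by apply: computable_muln; computability.
Qed.

Lemma computable_eqn : computable (fun e => f e == g e).
Proof.
apply: (@computable_ext _ _ _ _ (fun e => (f e - g e) + (g e - f e) == 0)).
  by move=> e; rewrite addn_eq0 !subn_eq0 -eqn_leq.
by apply: computable_eq0; apply: computable_addn; apply: computable_subn.
Qed.

End DerivedArithmetic2.

Lemma computable_modn (E : Type) (EE : Enc E) (f g : E -> nat) :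
  computable f -> computable g -> computable (fun e => f e %% g e).
Proof.
move=> Hf Hg; apply: (@computable_ext _ _ _ _
  (fun e => iter (f e) (fun r => if r.+1 == g e then 0 else r.+1) 0)).
  move=> e; elim: (f e) => [|n /= ->]; first by rewrite mod0n.
  case: (posnP (g e)) => [->|g0]; first by rewrite !modn0.
  rewrite -[n.+1]addn1 -(modnDml n) addn1.
  have := ltn_pmod n g0; rewrite leq_eqVlt => /orP[/eqP->|lt].
    by rewrite eqxx modnn.
  by rewrite (ltn_eqF lt) (modn_small lt).
apply: computable_iter => //; last exact: computable_const.
apply: computable_if; last by computability.
  by apply: computable_eqn; computability.
exact: computable_const.
Qed.

Section DerivedBool.
Context {E : Type} {EE : Enc E}.
Variables f g : E -> bool.
Hypotheses (Hf : computable f) (Hg : computable g).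

Lemma computable_negb : computable (fun e => ~~ f e).
Proof. by rewrite /negb; computability. Qed.

Lemma computable_andb : computable (fun e => f e && g e).
Proof. by rewrite /andb; computability. Qed.

Lemma computable_orb : computable (fun e => f e || g e).
Proof. by rewrite /orb; computability. Qed.

Lemma computable_eqb : computable (fun e => f e == g e).
Proof.
apply: (@computable_ext _ _ _ _ (fun e => if f e then g e else ~~ g e)).
  by move=> e; case: (f e); case: (g e).
by rewrite /negb; computability.
Qed.

End DerivedBool.

Section DerivedSeq.
Context {E A B : Type} {EE : Enc E} {EA : Enc A} {EB : Enc B}.

Lemma computable_rev (l : E -> seq A) : computable l -> computable (fun e => rev (l e)).
Proof.
move=> Hl; apply: (@computable_ext _ _ _ _ (fun e => foldl (fun s x => x :: s) [::] (l e))).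
  move=> e; rewrite -[RHS]cats0; elim: (l e) [::] => //= x s IH acc.
  by rewrite IH rev_cons cat_rcons.
by computability.
Qed.

Lemma computable_foldr (f : E -> A -> B -> B) (b : E -> B) (l : E -> seq A) :
  computable (fun z : E * (B * A) => f z.1 z.2.2 z.2.1) ->
  computable b -> computable l ->
  computable (fun e => foldr (f e) (b e) (l e)).
Proof.
move=> Hf Hb Hl; apply: (@computable_ext _ _ _ _
  (fun e => foldl (fun acc x => f e x acc) (b e) (rev (l e)))).
  by move=> e; rewrite foldl_rev.
by apply: computable_foldl => //; apply: computable_rev.
Qed.

End DerivedSeq.

Ltac computable_arithmetic :=
  lazymatch goal with
  | |- computable (fun _ => addn _ _) => apply: computable_addn
  | |- computable (fun _ => subn _ _) => apply: computable_subn
  | |- computable (fun _ => muln _ _) => apply: computable_muln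
  | |- computable (fun _ => expn _ _) => apply: computable_expn
  | |- computable (fun _ => @eq_op _ _ _) =>
      first [apply: computable_eqn | apply: computable_eqb]
  | |- computable (fun _ => modn _ _) => apply: computable_modn
  | |- computable (fun _ => negb _) => apply: computable_negb
  | |- computable (fun _ => andb _ _) => apply: computable_andb
  | |- computable (fun _ => orb _ _) => apply: computable_orb
  | |- computable (fun _ => foldr _ _ _) => apply: computable_foldr
  end.
Ltac computable_hook ::= computable_arithmetic.

Section DerivedSeq2.
Context {E A B : Type} {EE : Enc E} {EA : Enc A} {EB : Enc B}.

Lemma computable_cat (f g : E -> seq A) :
  computable f -> computable g -> computable (fun e => f e ++ g e).
Proof.
move=> Hf Hg; apply: (@computable_ext _ _ _ _ (fun e => foldr cons (g e) (f e))).
  by move=> e; elim: (f e) => //= x s ->.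
by computability.
Qed.

Lemma computable_map (f : E -> A -> B) (l : E -> seq A) :
  computable (fun z : E * A => f z.1 z.2) -> computable l ->
  computable (fun e => map (f e) (l e)).
Proof.
move=> Hf Hl; apply: (@computable_ext _ _ _ _
  (fun e => foldr (fun x s => f e x :: s) [::] (l e))).
  by move=> e; elim: (l e) => //= x s ->.
by computability.
Qed.

Lemma computable_filter (a : E -> A -> bool) (l : E -> seq A) :
  computable (fun z : E * A => a z.1 z.2) -> computable l ->
  computable (fun e => filter (a e) (l e)).
Proof.
move=> Ha Hl; apply: (@computable_ext _ _ _ _
  (fun e => foldr (fun x s => if a e x then x :: s else s) [::] (l e))).
  by move=> e; elim: (l e) => //= x s ->.
by computability.
Qed.

Lemma computable_all (a : E -> A -> bool) (l : E -> seq A) :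
  computable (fun z : E * A => a z.1 z.2) -> computable l ->
  computable (fun e => all (a e) (l e)).
Proof.
move=> Ha Hl; apply: (@computable_ext _ _ _ _
  (fun e => foldr (fun x b => a e x && b) true (l e))).
  by move=> e; elim: (l e) => //= x s ->.
by computability.
Qed.

Lemma computable_has (a : E -> A -> bool) (l : E -> seq A) :
  computable (fun z : E * A => a z.1 z.2) -> computable l ->
  computable (fun e => has (a e) (l e)).
Proof.
move=> Ha Hl; apply: (@computable_ext _ _ _ _
  (fun e => foldr (fun x b => a e x || b) false (l e))).
  by move=> e; elim: (l e) => //= x s ->.
by computability.
Qed.

Lemma computable_size (l : E -> seq A) : computable l -> computable (fun e => size (l e)).
Proof.
move=> Hl; apply: (@computable_ext _ _ _ _ (fun e => foldr (fun _ n => n.+1) 0 (l e))).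
  by move=> e; elim: (l e) => //= x s ->.
by computability.
Qed.

Lemma computable_nth (d : E -> A) (l : E -> seq A) (n : E -> nat) :
  computable d -> computable l -> computable n ->
  computable (fun e => nth (d e) (l e) (n e)).
Proof.
move=> Hd Hl Hn; apply: (@computable_ext _ _ _ _
  (fun e => head (d e) (iter (n e) behead (l e)))).
  move=> e; elim: (n e) (l e) => [|k IH] s; first by rewrite nth0.
  by rewrite iterSr IH; case: s => //=; rewrite nth_nil.
by computability.
Qed.

End DerivedSeq2.

Lemma computable_flatten (E A : Type) (EE : Enc E) (EA : Enc A) (l : E -> seq (seq A)) :
  computable l -> computable (fun e => flatten (l e)).
Proof.
by move=> Hl; rewrite /flatten; computability; apply: computable_cat; computability.
Qed.

Lemma computable_sumn (E : Type) (EE : Enc E) (l : E -> seq nat) :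
  computable l -> computable (fun e => sumn (l e)).
Proof. by move=> Hl; rewrite /sumn; computability. Qed.

Lemma computable_iota (E : Type) (EE : Enc E) (m n : E -> nat) :
  computable m -> computable n -> computable (fun e => iota (m e) (n e)).
Proof.
move=> Hm Hn; apply: (@computable_ext _ _ _ _
  (fun e => map (addn (m e)) (iter (n e) (fun s => s ++ [:: size s]) [::]))).
  move=> e; have -> : iter (n e) (fun s => s ++ [:: size s]) [::] = iota 0 (n e).
    by elim: (n e) => // k IH; rewrite iterS IH size_iota -[in RHS]addn1 iotaD.
  by rewrite -iotaDl addn0.
apply: computable_map; computability.
by apply: computable_cat; computability; apply: computable_size; computability.
Qed.

Lemma computable_allpairs (E A B C : Type) (EE : Enc E) (EA : Enc A) (EB : Enc B)
    (EC : Enc C) (f : E -> A -> B -> C) (s : E -> seq A) (t : E -> A -> seq B) :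
  computable (fun z : E * A * B => f z.1.1 z.1.2 z.2) ->
  computable s -> computable (fun z : E * A => t z.1 z.2) ->
  computable (fun e => [seq f e x y | x <- s e, y <- t e x]).
Proof.
move=> Hf Hs Ht; apply: computable_flatten; apply: computable_map => //.
by apply: computable_map.
Qed.

Ltac computable_list :=
  lazymatch goal with
  | |- computable (fun _ => cat _ _) => apply: computable_cat
  | |- computable (fun _ => filter _ _) => apply: computable_filter
  | |- computable (fun _ => all _ _) => apply: computable_all
  | |- computable (fun _ => has _ _) => apply: computable_has
  | |- computable (fun _ => size _) => apply: computable_size
  | |- computable (fun _ => nth _ _ _) => apply: computable_nth
  | |- computable (fun _ => sumn _) => apply: computable_sumn
  | |- computable (fun _ => iota _ _) => apply: computable_iota
  | |- computable (fun _ => flatten (map (fun _ => map _ _) _)) =>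
      apply: computable_allpairs
  | |- computable (fun _ => flatten _) => apply: computable_flatten
  | |- computable (fun _ => map _ _) => apply: computable_map
  | _ => computable_arithmetic
  end.
Ltac computable_hook ::= computable_list.

(** * An automaton built from a membership test *)

(** These serve as letters, listed by their digits, and as exponents. *)
Definition box (n k : nat) : seq (seq nat) :=
  iter n (fun s => [seq a :: v | a <- iota 0 k, v <- s]) [:: [::]].

Lemma mem_box n k v : (v \in box n k) = (size v == n) && all (fun a => a < k) v.
Proof.
elim: n v => [|n IH] v /=; first by rewrite inE; case: v.
apply/allpairsP/idP => [[[a v'] /= [ai v'i ->]]|].
  by move: v'i; rewrite IH mem_iota /= eqSS in ai * => /andP[-> ->]; rewrite ai.
case: v => // a v /=; rewrite eqSS => /and3P[sv ak av].
by exists (a, v); rewrite mem_iota ak IH sv av.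
Qed.

Definition words (p t l : nat) : seq (seq (seq nat)) :=
  iter l (fun s => [::] :: [seq a :: u | a <- box t p, u <- s]) [:: [::]].

Lemma mem_words p t l u :
  (u \in words p t l) = (size u <= l) && all (fun a => a \in box t p) u.
Proof.
elim: l u => [|l IH] u /=; first by rewrite inE; case: u.
rewrite inE; case: u => [|a u] //=.
apply/allpairsP/idP => [[[b v] /= [bi vi [-> ->]]]|].
  by move: vi; rewrite IH bi ltnS.
by rewrite ltnS => /and3P[su ai au]; exists (a, u); rewrite IH ai su au.
Qed.

Lemma nth_words0 p t l : nth [::] (words p t l) 0 = [::].
Proof. by case: l. Qed.

Lemma words_gt0 p t l : 0 < size (words p t l).
Proof. by case: l. Qed.

(** Number of states, initial state, final states and edges, in the order in
    which an automaton is encoded. *)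
Notation raw_automaton := (nat * (nat * (seq nat * seq (nat * (seq nat * nat)))))%type.

(** The states are the words of length at most l, among them several for each
    Nerode class, so the automaton is not deterministic: an edge labelled a
    leads from u to every u' that no v of length at most l separates from ua. *)
Definition test_automaton (L : seq (seq nat) -> bool) (p t l : nat) : raw_automaton :=
  (size (words p t l), (0,
    ([seq i <- iota 0 (size (words p t l)) | L (nth [::] (words p t l) i)],
     [seq e <- [seq (i, aj) | i <- iota 0 (size (words p t l)),
                aj <- [seq (a, j) | a <- box t p, j <- iota 0 (size (words p t l))]] |
      all (fun v => L (nth [::] (words p t l) e.1 ++ e.2.1 :: v) ==
                    L (nth [::] (words p t l) e.2.2 ++ v))
          (words p t l)]))).

Lemma enc_seq_map (A B : Type) (e : B -> tree) (f : A -> B) s :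
  enc_seq e (map f s) = enc_seq (fun x => e (f x)) s.
Proof. exact: foldr_map. Qed.

Lemma eq_in_enc_seq (A : eqType) (e e' : A -> tree) (s : seq A) :
  {in s, e =1 e'} -> enc_seq e s = enc_seq e' s.
Proof.
elim: s => //= x s IH ee; rewrite ee ?mem_head // IH // => y ys.
by apply: ee; rewrite inE ys orbT.
Qed.

Section RawLetters.
Variables (p t : nat).

Definition raw_letter (a : letter p t) : seq nat := [seq (a k : nat) | k <- enum 'I_t].

Lemma enc_raw_letter a : enc_letter a = enc (raw_letter a).
Proof. by rewrite /enc_letter /enc_fun -[RHS]/(enc_seq enc_nat _) !enc_seq_map. Qed.

Lemma raw_letter_box a : raw_letter a \in box t p.
Proof.
rewrite mem_box size_map size_enum_ord eqxx /=.
by apply/allP => _ /mapP[k _ ->].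
Qed.

Lemma nth_raw_letter a (k : 'I_t) : nth 0 (raw_letter a) k = a k.
Proof. by rewrite (nth_map k) ?size_enum_ord // nth_ord_enum. Qed.

Lemma raw_letter_inj : injective raw_letter.
Proof.
move=> a b E; apply/ffunP => k; apply/val_inj.
by rewrite /= -!nth_raw_letter E.
Qed.

Hypothesis p_gt0 : 0 < p.

Definition letter_of_raw (v : seq nat) : letter p t :=
  [ffun k : 'I_t => insubd (Ordinal p_gt0) (nth 0 v k)].

Lemma letter_of_rawK v : v \in box t p -> raw_letter (letter_of_raw v) = v.
Proof.
rewrite mem_box => /andP[/eqP sv /allP av].
apply: (@eq_from_nth _ 0); first by rewrite size_map size_enum_ord sv.
rewrite size_map size_enum_ord => i it; rewrite (nth_raw_letter _ (Ordinal it)) ffunE.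
by rewrite val_insubd av // mem_nth // sv.
Qed.

Definition word_of_raw (u : seq (seq nat)) : seq (letter p t) := map letter_of_raw u.

Lemma word_of_rawK l u : u \in words p t l -> map raw_letter (word_of_raw u) = u.
Proof.
rewrite mem_words => /andP[_ /allP au]; rewrite -map_comp -[RHS]map_id.
by apply/eq_in_map => a /au; exact: letter_of_rawK.
Qed.

Lemma raw_word_mem l (u : seq (letter p t)) :
  (map raw_letter u \in words p t l) = (size u <= l).
Proof.
rewrite mem_words size_map; case: leqP => //= _.
by apply/allP => _ /mapP[a _ ->]; exact: raw_letter_box.
Qed.

Lemma realize_automaton (n i0 : nat) (fin : seq nat) (edg : seq (nat * (seq nat * nat))) :
  i0 < n -> all (fun i => i < n) fin ->
  all (fun e => [&& e.1 < n, e.2.1 \in box t p & e.2.2 < n]) edg ->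
  exists M : automaton (letter p t),
    [/\ enc_automaton M = enc ((n, (i0, (fin, edg))) : raw_automaton),
        nstates M = n, init M = i0 :> nat,
        forall y, (y \in final M) = ((y : nat) \in fin) &
        forall x a y, ((x, a, y) \in edges M) = (((x : nat), (raw_letter a, (y : nat))) \in edg)].
Proof.
move=> i0n /allP Hfin /allP Hedg.
pose st i : 'I_n := insubd (Ordinal i0n) i.
have stK i : i < n -> st i = i :> nat by move=> ilt; rewrite /st val_insubd ilt.
have stV (x : 'I_n) : st x = x by apply/val_inj; rewrite /= stK.
pose mk (e : nat * (seq nat * nat)) := (st e.1, letter_of_raw e.2.1, st e.2.2).
pose raw (e : 'I_n * letter p t * 'I_n) : nat * (seq nat * nat) :=
  (e.1.1 : nat, (raw_letter e.1.2, e.2 : nat)).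
have mkK e : e \in edg -> raw (mk e) = e.
  move=> /Hedg /and3P[e1 e2 e3]; rewrite /raw /= !stK // letter_of_rawK //.
  by case: (e) => ? [].
exists (Automaton (Ordinal i0n) (map st fin) (map mk edg)); split=> //=.
- rewrite /enc_automaton /= /enc /= /Enc_prod /=.
  congr (Node _ (Node _ (Node _ _))).
    by rewrite enc_seq_map; apply: eq_in_enc_seq => i /Hfin ilt; rewrite stK.
  rewrite enc_seq_map; apply: eq_in_enc_seq => e /mkK E; rewrite -[in RHS]E.
  by rewrite enc_raw_letter.
- move=> y; apply/mapP/idP => [[i ifin ->]|yfin]; first by rewrite stK // Hfin.
  by exists (y : nat) => //; rewrite stV.
- move=> x a y; apply/mapP/idP => [[e ee E]|ee].
    by have := mkK e ee; rewrite -E /raw /= => ->.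
  exists (x : nat, (raw_letter a, y : nat)) => //.
  rewrite /mk /= !stV; congr (_, _, _); apply: raw_letter_inj.
  by rewrite letter_of_rawK // raw_letter_box.
Qed.

End RawLetters.

(** A word longer than the number of states repeats a state, and the loop can
    be cut out. *)
Lemma short_word (A : Type) (X : finType) (step : X -> A -> X) (x : X) (u : seq A) :
  exists2 v, size v < #|X| & foldl step x v = foldl step x u.
Proof.
have [n] := ubnP (size u); elim: n u => // n IH u un.
have [|ge] := ltnP (size u) #|X|; first by exists u.
pose f (i : 'I_(size u).+1) := foldl step x (take i u).
have : ~~ injectiveb f.
  apply/negP => /injectiveP fI; have := leq_card f fI.
  by rewrite card_ord leqNgt ltnS ge.
case/injectivePn => i [j ij fij].
wlog lt_ij : i j ij fij / i < j.
  move=> H; case: (ltngtP i j) => [lt|lt|E]; first exact: (H i j).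
    by apply: (H j i) => //; rewrite eq_sym.
  by case/eqP: ij; apply/val_inj.
have ju : j <= size u by rewrite -ltnS.
have [|v sv Ev] := IH (take i u ++ drop j u).
  rewrite size_cat size_drop size_takel ?(leq_trans (ltnW lt_ij)) //.
  by move: un; rewrite ltnS; lia.
exists v => //; rewrite Ev foldl_cat -/(f i) fij -foldl_cat.
by rewrite cat_take_drop.
Qed.

Section TestAutomaton.
Variables (p t : nat) (p_gt0 : 0 < p).
Variables (X : finType) (x0 : X) (step : X -> letter p t -> X) (accept : X -> bool).
Variable L : seq (seq nat) -> bool.
Hypothesis L_accept : forall u, L (map (@raw_letter p t) u) = accept (foldl step x0 u).
Variable l : nat.
Hypothesis l_big : #|X| * #|X| <= l.

Local Notation W := (words p t l).
Local Notation raw := (map (@raw_letter p t)).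

Let X_gt0 : 0 < #|X|. Proof. by apply/card_gt0P; exists x0. Qed.
Let X_l : #|X| <= l. Proof. by apply: leq_trans l_big; rewrite leq_pmulr. Qed.

Definition indistinguishable (u v : seq (letter p t)) : Prop :=
  forall z, L (raw (u ++ z)) = L (raw (v ++ z)).

(** If a word separates u from v then a word of length less than |X|^2 does,
    by the pigeonhole principle on pairs of states. *)
Lemma indistinguishableP u v :
  (forall z, size z <= l -> L (raw (u ++ z)) = L (raw (v ++ z))) ->
  indistinguishable u v.
Proof.
move=> H z; pose step2 (x : X * X) a := (step x.1 a, step x.2 a).
have foldl2 x y s : foldl step2 (x, y) s = (foldl step x s, foldl step y s).
  by elim: s x y => //= a s IH x y; rewrite IH.
have [z' sz] := short_word step2 (foldl step x0 u, foldl step x0 v) z.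
rewrite !foldl2 => -[E1 E2]; rewrite !L_accept !foldl_cat -E1 -E2 -!foldl_cat -!L_accept.
by apply: H; apply: leq_trans l_big; rewrite -card_prod ltnW.
Qed.

Lemma test_automaton_recognizes : exists M : automaton (letter p t),
  enc_automaton M = enc (test_automaton L p t l) /\ recognizes M (fun u => L (raw u)).
Proof.
pose n := size W.
have [|||M [encM nM initM finM edgM]] := @realize_automaton p t p_gt0 n 0
  [seq i <- iota 0 n | L (nth [::] W i)]
  [seq e <- [seq (i, aj) | i <- iota 0 n, aj <- [seq (a, j) | a <- box t p, j <- iota 0 n]] |
      all (fun v => L (nth [::] W e.1 ++ e.2.1 :: v) == L (nth [::] W e.2.2 ++ v)) W].
- exact: words_gt0.
- by rewrite all_filter; apply/allP => i; rewrite mem_iota /= => ->; rewrite implybT.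
- rewrite all_filter; apply/allP => e /allpairsP[[i aj] /= [ii aji ->]].
  move: aji => /allpairsP[[a j] /= [ai ji ->]]; apply/implyP => _ /=.
  by move: ii ji; rewrite !mem_iota /= ai => -> ->.
exists M; split=> //.
pose word (x : 'I_(nstates M)) := word_of_raw t p_gt0 (nth [::] W x).
have ltn_st (x : 'I_(nstates M)) : x < n by rewrite -nM.
have wordK x : raw (word x) = nth [::] W x.
  by apply: (@word_of_rawK _ _ _ l); rewrite mem_nth // ltn_st.
have fin_word y : (y \in final M) = L (raw (word y)).
  by rewrite finM mem_filter mem_iota /= ltn_st andbT wordK.
have edge_word x a y : (x, a, y) \in edges M <->
    indistinguishable (word x ++ [:: a]) (word y).
  rewrite edgM mem_filter; split=> [/andP[/allP /= H _]|H].
    apply: indistinguishableP => z zl.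
    have := H (raw z); rewrite raw_word_mem => /(_ zl)/eqP.
    by rewrite -catA !map_cat /= !wordK.
  apply/andP; split; last first.
    apply/allpairsP; exists (x : nat, (raw_letter a, y : nat)); split=> //=.
      by rewrite mem_iota /= ltn_st.
    apply/allpairsP; exists (raw_letter a, y : nat); split=> //=.
      exact: raw_letter_box.
    by rewrite mem_iota /= ltn_st.
  apply/allP => v vW /=; have := H (word_of_raw t p_gt0 v).
  by rewrite -catA !map_cat /= !wordK (word_of_rawK _ vW) => ->.
have reads_word x u y : reads x u y -> indistinguishable (word x ++ u) (word y).
  elim: u x => [|a u IH] x /=; first by move=> ->; rewrite cats0.
  case=> z /edge_word Hxz /IH Hzy v.
  by rewrite -cat1s catA -catA Hxz catA Hzy.
have reads_total (x : 'I_(nstates M)) (u : seq (letter p t)) : exists y, reads x u y.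
  elim: u x => [|a u IH] x /=; first by exists x.
  have [v vX Ev] := short_word step x0 (word x ++ [:: a]).
  have vW : raw v \in W by rewrite raw_word_mem ltnW // (leq_trans vX).
  have iz : index (raw v) W < nstates M by rewrite nM index_mem.
  have [y Hy] := IH (Ordinal iz); exists y; exists (Ordinal iz) => //.
  apply/edge_word => z; rewrite [in RHS]map_cat wordK /= nth_index // -map_cat.
  by rewrite !L_accept !foldl_cat Ev foldl_cat.
have word_init : word (init M) = [::] by rewrite /word initM nth_words0.
move=> u; split=> [Lu|[y yfin Hy]].
  have [y Hy] := reads_total (init M) u; exists y => //.
  have := reads_word _ _ _ Hy [::]; rewrite word_init !cats0 /= fin_word => <-.
  exact: Lu.
have := reads_word _ _ _ Hy [::]; rewrite word_init !cats0 /= => ->.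
by rewrite -fin_word.
Qed.

End TestAutomaton.

Lemma computable_box (E : Type) (EE : Enc E) (n k : E -> nat) :
  computable n -> computable k -> computable (fun e => box (n e) (k e)).
Proof. by move=> Hn Hk; rewrite /box; computability. Qed.

Lemma computable_words (E : Type) (EE : Enc E) (p t l : E -> nat) :
  computable p -> computable t -> computable l ->
  computable (fun e => words (p e) (t e) (l e)).
Proof.
move=> Hp Ht Hl; rewrite /words; computability.
by apply: computable_box; computability.
Qed.

Ltac computable_word :=
  lazymatch goal with
  | |- computable (fun _ => box _ _) => apply: computable_box
  | |- computable (fun _ => words _ _ _) => apply: computable_words
  | _ => computable_list
  end.
Ltac computable_hook ::= computable_word.

Lemma computable_test_automaton (E : Type) (EE : Enc E)
    (L : E -> seq (seq nat) -> bool) (p t l : E -> nat) :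
  computable (fun z : E * seq (seq nat) => L z.1 z.2) ->
  computable p -> computable t -> computable l ->
  computable (fun e => test_automaton (L e) (p e) (t e) (l e)).
Proof. by move=> HL Hp Ht Hl; rewrite /test_automaton; computability. Qed.

Lemma Fp_expp (p : nat) (x : 'F_p) : prime p -> (x ^+ p = x)%R.
Proof.
move=> /pchar_Fp Hp.
by rewrite -[x]natr_Zp -(pFrobenius_autE Hp) pFrobenius_aut_nat.
Qed.

(** * Linear maps on polynomials given on monomials *)

Section LinearExtension.
Local Open Scope ring_scope.
Variables (R : nzRingType) (m : nat) (V : lmodType R) (theta : 'X_{1..m} -> V).

Definition lext (f : {mpoly R[m]}) : V := \sum_(u <- msupp f) f@_u *: theta u.

Lemma lextE k f : (msize f <= k)%N -> lext f = \sum_(u : 'X_{1..m < k}) f@_u *: theta u.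
Proof.
move=> fk; pose I : subFinType _ := 'X_{1..m < k}.
rewrite /lext (big_mksub I) //=; first last.
- by move=> x /msize_mdeg_lt /leq_trans; apply.
- by rewrite msupp_uniq.
by rewrite big_rmcond //= => i /memN_msupp_eq0 ->; rewrite scale0r.
Qed.

Lemma lext_is_linear : linear lext.
Proof.
move=> a f g; pose k := maxn (msize (a *: f + g)) (maxn (msize f) (msize g)).
rewrite !(@lextE k) ?leq_max ?leqnn ?orbT //.
rewrite scaler_sumr -big_split; apply: eq_bigr => u _.
by rewrite /= mcoeffD mcoeffZ scalerDl scalerA.
Qed.

HB.instance Definition _ := GRing.isLinear.Build R {mpoly R[m]} V *:%R lext lext_is_linear.

Lemma lextX u : lext 'X_[u] = theta u.
Proof. by rewrite /lext msuppX big_seq1 mcoeffX eqxx scale1r. Qed.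

End LinearExtension.

(** Additive statements need to be checked on single terms only. *)
Lemma mpoly_additive_ind (R : nzRingType) (m : nat) (Q : {mpoly R[m]} -> Prop) :
  Q 0%R -> (forall f g, Q f -> Q g -> Q (f + g)%R) ->
  (forall a u, Q (a *: 'X_[u])%R) -> forall f, Q f.
Proof. by move=> Q0 QD QX f; rewrite [f]mpolyE; elim/big_ind: _. Qed.

(** * Degree filtrations *)

Section Filtration.
Local Open Scope ring_scope.

(** Degree bounds are only used through these rules, for polynomials in several
    variables as well as coefficientwise and entrywise. *)
Record filtration (R : nzRingType) (D : nat -> R -> Prop) : Prop := Filtration {
  filtW : forall k l x, (k <= l)%N -> D k x -> D l x;
  filt0 : forall k, D k 0;
  filt1 : D 0%N 1;
  filtN : forall k x, D k x -> D k (- x);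
  filtD : forall k x y, D k x -> D k y -> D k (x + y);
  filtM : forall k l x y, D k x -> D l y -> D (k + l)%N (x * y)
}.

Variables (R : nzRingType) (D : nat -> R -> Prop) (FD : filtration D).

Lemma filt_sum k (I : Type) (r : seq I) (Q : pred I) (F : I -> R) :
  (forall i, Q i -> D k (F i)) -> D k (\sum_(i <- r | Q i) F i).
Proof. by move=> DF; elim/big_ind: _ => //; [exact: filt0 | apply: (filtD FD)]. Qed.

Lemma filt_prod (I : Type) (r : seq I) (d : I -> nat) (F : I -> R) :
  (forall i, D (d i) (F i)) -> D (\sum_(i <- r) d i) (\prod_(i <- r) F i).
Proof.
move=> DF; elim: r => [|i r IH]; rewrite ?big_nil ?big_cons; first exact: filt1.
exact: (filtM FD).
Qed.

Lemma filt_prod_ord n k (F : 'I_n -> R) :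
  (forall i, D k (F i)) -> D (n * k) (\prod_(i < n) F i).
Proof.
move=> DF; have -> : (n * k = \sum_(i < n) k)%N by rewrite sum_nat_const card_ord.
exact: filt_prod.
Qed.

Lemma filtX n k x : D k x -> D (n * k) (x ^+ n).
Proof. by move=> Dx; rewrite -[n in x ^+ n]card_ord -prodr_const; exact: filt_prod_ord. Qed.

Lemma filt_sign k n x : D k x -> D k ((-1) ^+ n * x).
Proof.
move=> Dx; rewrite -signr_odd; case: (odd n); last by rewrite mul1r.
by rewrite expr1 mulN1r; exact: filtN.
Qed.

End Filtration.

Lemma filt_det (R : comNzRingType) (D : nat -> R -> Prop) n k (A : 'M[R]_n) :
  filtration D -> (forall i j, D k (A i j)) -> D (n * k) (\det A)%R.
Proof.
move=> FD DA; apply: (filt_sum FD) => s _.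
by apply: (filt_sign FD); apply: (filt_prod_ord FD).
Qed.

Section FiltrationInstances.
Local Open Scope ring_scope.

Definition deg_le (R : nzRingType) (m k : nat) (f : {mpoly R[m]}) : Prop := (msize f <= k.+1)%N.

Lemma deg_le_filtration (R : nzRingType) (m : nat) : filtration (@deg_le R m).
Proof.
split; rewrite /deg_le.
- by move=> k l f kl; move/leq_trans; apply.
- by move=> k; rewrite msize0.
- by rewrite msize1.
- by move=> k f; rewrite msizeN.
- by move=> k f g fk gk; rewrite (leq_trans (msizeD_le _ _)) // geq_max fk.
- move=> k l f g.
  have [->|nzf] := eqVneq f 0; first by rewrite mul0r msize0.
  have [->|nzg] := eqVneq g 0; first by rewrite mulr0 msize0.
  have [->|nzfg] := eqVneq (f * g) 0; first by rewrite msize0.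
  rewrite -!mlead_deg // !ltnS => fk gl.
  have /lemc_mdeg := mleadM_le f g; rewrite mdegD => /leq_trans; apply.
  exact: leq_add.
Qed.

Lemma deg_leC (R : nzRingType) (m k : nat) (c : R) : deg_le k (c%:MP_[m]).
Proof. by rewrite /deg_le msizeC; case: (c != 0). Qed.

Lemma deg_leX (R : nzRingType) (m k : nat) (u : 'X_{1..m}) :
  (mdeg u <= k)%N -> deg_le k ('X_[u] : {mpoly R[m]}).
Proof. by rewrite /deg_le msizeX ltnS. Qed.

Lemma deg_leZ (R : nzRingType) (m k : nat) (c : R) (f : {mpoly R[m]}) :
  deg_le k f -> deg_le k (c *: f).
Proof.
move=> fk; rewrite -mul_mpolyC -[k]add0n.
by apply: (filtM (deg_le_filtration _ _)) => //; exact: deg_leC.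
Qed.

Variables (R : comNzRingType) (D : nat -> R -> Prop) (FD : filtration D).

Definition coef_filt (k : nat) (f : {poly R}) : Prop := forall i, D k f`_i.

Lemma coef_filtration : filtration coef_filt.
Proof.
split=> [k l f kl fk i|k i||k f fk i|k f g fk gk i|k l f g fk gl i].
- exact: (filtW FD kl).
- by rewrite coef0; exact: (filt0 FD).
- by move=> i; rewrite coef1; case: (i == 0%N); [exact: (filt1 FD) | exact: (filt0 FD)].
- by rewrite coefN; exact: (filtN FD).
- by rewrite coefD; exact: (filtD FD).
- by rewrite coefM; apply: (filt_sum FD) => j _; exact: (filtM FD).
Qed.

Definition mx_filt n (k : nat) (A : 'M[R]_n.+1) : Prop := forall i j, D k (A i j).

Lemma mx_filtration n : filtration (@mx_filt n).
Proof.
split=> [k l f kl fk i j|k i j||k f fk i j|k f g fk gk i j|k l f g fk gl i j].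
- exact: (filtW FD kl).
- by rewrite mxE; exact: (filt0 FD).
- by move=> i j; rewrite mxE; case: (i == j); [exact: (filt1 FD) | exact: (filt0 FD)].
- by rewrite mxE; exact: (filtN FD).
- by rewrite mxE; exact: (filtD FD).
- by rewrite mxE; apply: (filt_sum FD) => h _; exact: (filtM FD).
Qed.

Lemma char_poly_filt n k (A : 'M[R]_n) :
  (forall i j, D k (A i j)) -> coef_filt (n * k) (char_poly A).
Proof.
move=> DA; apply: (filt_det coef_filtration) => i j l.
rewrite /char_poly_mx !mxE coefB coefMn coefX coefC.
apply: (filtD FD); last first.
  by apply: (filtN FD); case: (l == 0%N); [exact: DA | exact: (filt0 FD)].
apply: (filtW FD (leq0n k)).
by case: (l == 1%N); case: (i == j); rewrite ?mulr1n ?mulr0n ?mul0rn;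
  [exact: (filt1 FD)|exact: (filt0 FD)..].
Qed.

End FiltrationInstances.

(** * Components over p-th powers *)

Section Components.
Local Open Scope ring_scope.
Variables (p m : nat) (F : fieldType).
Hypotheses (pF : p \in [pchar F]) (F_expp : forall x : F, x ^+ p = x).
Local Notation S := {mpoly F[m]}.
Local Notation E := {ffun 'I_m -> 'I_p}.

Let p_pr : prime p.
Proof. exact: pcharf_prime pF. Qed.

Lemma pchar_mpoly : p \in [pchar S].
Proof. by rewrite inE p_pr -mpolyC_nat (pcharf0 pF) mpolyC0 eqxx. Qed.

Lemma mpoly_expp0 : (0 : S) ^+ p = 0.
Proof. by rewrite expr0n eqn0Ngt prime_gt0. Qed.

Lemma mpoly_exppD (f g : S) : (f + g) ^+ p = f ^+ p + g ^+ p.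
Proof. by rewrite -!(pFrobenius_autE pchar_mpoly) rmorphD. Qed.

Lemma mpoly_exppX (a : F) u : (a *: 'X_[u] : S) ^+ p = a *: 'X_[u *+ p].
Proof. by rewrite exprZn F_expp mpolyXn. Qed.

Definition digit_mnm (e : E) : 'X_{1..m} := [multinom (e i : nat) | i < m].

(** The component of f at X^e over the subring of p-th powers, with its p-th
    root taken: f is the sum over e of (component e f)^p X^e. *)
Definition component (e : E) : S -> S := lext (fun u : 'X_{1..m} =>
  if [forall i, u i %% p == e i]%N then 'X_[ [multinom (u i %/ p)%N | i < m] ] else 0).

Lemma componentD e f g : component e (f + g) = component e f + component e g.
Proof. exact: raddfD. Qed.

Lemma component_expp e s f : component e (s ^+ p * f) = s * component e f.
Proof.
elim/mpoly_additive_ind: s => [|s1 s2 IH1 IH2|a v].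
- by rewrite mpoly_expp0 !mul0r /component raddf0.
- by rewrite mpoly_exppD !mulrDl componentD IH1 IH2.
elim/mpoly_additive_ind: f => [|f1 f2 IH1 IH2|b u].
- by rewrite !mulr0 /component raddf0 mulr0.
- by rewrite mulrDr !componentD mulrDr IH1 IH2.
rewrite mpoly_exppX -scalerAl -scalerAr -mpolyXD /component !linearZ /= !lextX.
rewrite -scalerAl -scalerAr; congr (_ *: (_ *: _)).
have -> : [forall i, (v *+ p + u)%MM i %% p == e i]%N = [forall i, u i %% p == e i]%N.
  by apply: eq_forallb => i; rewrite mnmDE mulmnE modnMDl.
case: ifP; rewrite ?mulr0 // -mpolyXD => _; congr 'X_[_].
by apply/mnmP => i; rewrite !mnmE mulmnE divnMDl ?prime_gt0.
Qed.

Lemma component_digit e e' : component e 'X_[digit_mnm e'] = (e == e')%:R.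
Proof.
rewrite /component lextX; case: (eqVneq e e') => [<-|ne].
  have -> : [forall i, digit_mnm e i %% p == e i]%N.
    by apply/forallP => i; rewrite mnmE modn_small.
  rewrite -mpolyX0; congr 'X_[_]; apply/mnmP => i.
  by rewrite !mnmE divn_small.
case: ifP => // /forallP H; case/eqP: ne; apply/ffunP => i; apply/val_inj.
by rewrite /= -(eqP (H i)) mnmE modn_small.
Qed.

Lemma component_sum f : f = \sum_e component e f ^+ p * 'X_[digit_mnm e].
Proof.
elim/mpoly_additive_ind: f => [|f1 f2 IH1 IH2|a u].
- rewrite big1 // => e _.
  by rewrite /component raddf0 mpoly_expp0 mul0r.
- rewrite {1}IH1 {1}IH2 -big_split; apply: eq_bigr => e _.
  by rewrite componentD mpoly_exppD mulrDl.
pose e0 : E := [ffun i => Ordinal (ltn_pmod (u i) (prime_gt0 p_pr))].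
rewrite (bigD1 e0) //= big1 ?addr0 => [|e ne].
  rewrite /component linearZ /= lextX.
  have -> : [forall i, u i %% p == e0 i]%N by apply/forallP => i; rewrite ffunE.
  rewrite mpoly_exppX -scalerAl -mpolyXD; congr (_ *: 'X_[_]).
  by apply/mnmP => i; rewrite mnmDE mulmnE !mnmE ffunE -divn_eq.
rewrite /component linearZ /= lextX.
case: ifP => [/forallP H|_]; last first.
  by rewrite scaler0 mpoly_expp0 mul0r.
case/eqP: ne; apply/ffunP => i; apply/val_inj.
by rewrite /= -(eqP (H i)) ffunE.
Qed.

Lemma deg_le_component e k f : deg_le k f -> deg_le (k %/ p) (component e f).
Proof.
move=> fk; rewrite /component /lext big_seq.
apply: (filt_sum (deg_le_filtration _ _)) => /= u uf; apply: deg_leZ.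
case: ifP => _; last exact: (filt0 (deg_le_filtration _ _)).
apply: deg_leX; rewrite leq_divRL ?prime_gt0 //.
have : (mdeg u <= k)%N by rewrite -ltnS (leq_trans (msize_mdeg_lt uf)).
apply: leq_trans; rewrite !mdegE big_distrl /=; apply: leq_sum => i _.
by rewrite mnmE leq_divM.
Qed.

Lemma deg_le_digit e : deg_le (m * p) ('X_[digit_mnm e] : S).
Proof.
apply: deg_leX; rewrite mdegE -[m in X in (_ <= X)%N]card_ord -sum_nat_const.
by apply: leq_sum => i _; rewrite mnmE ltnW.
Qed.

End Components.

(** * A zero test by p-th roots *)

Section ZeroTest.
Local Open Scope ring_scope.
Variables (p m : nat) (F : fieldType).
Hypotheses (pF : p \in [pchar F]) (F_expp : forall x : F, x ^+ p = x).
Local Notation S := {mpoly F[m]}.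
Local Notation E := {ffun 'I_m -> 'I_p}.
Local Notation "'x^ e" := ('X_[digit_mnm (e : E)] : S) (at level 2, e at level 2).

(** The form with values w e at the X^e that is linear up to p-th roots. *)
Definition root_form (w : E -> S) (f : S) : S := \sum_e w e * component e f.

Lemma root_formD w f g : root_form w (f + g) = root_form w f + root_form w g.
Proof.
by rewrite /root_form -big_split; apply: eq_bigr => e _; rewrite componentD mulrDr.
Qed.

Lemma root_form0 w : root_form w 0 = 0.
Proof. by apply: (@addIr _ (root_form w 0)); rewrite -root_formD !add0r. Qed.

Lemma root_form_sum w I (r : seq I) (Q : pred I) (G : I -> S) :
  root_form w (\sum_(i <- r | Q i) G i) = \sum_(i <- r | Q i) root_form w (G i).
Proof. exact: (big_morph _ (root_formD w) (root_form0 w)). Qed.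

Lemma root_form_expp w s f : root_form w (s ^+ p * f) = s * root_form w f.
Proof.
by rewrite /root_form mulr_sumr; apply: eq_bigr => e _; rewrite (component_expp pF) // mulrCA.
Qed.

Lemma root_form_digit w e : root_form w 'x^e = w e.
Proof.
rewrite /root_form (bigD1 e) //= big1 ?addr0 => [|e' ne].
  by rewrite component_digit eqxx mulr1.
by rewrite component_digit (negbTE ne) mulr0.
Qed.

Lemma deg_le_root_form w k l f : (forall e, deg_le k (w e)) -> deg_le l f ->
  deg_le (k + l %/ p) (root_form w f).
Proof.
move=> wk fl; apply: (filt_sum (deg_le_filtration _ _)) => e _.
by apply: (filtM (deg_le_filtration _ _)) => //; apply: deg_le_component.
Qed.

Let p_pr : prime p.
Proof. exact: pcharf_prime pF. Qed.

Variables (K : fieldType) (ev : {rmorphism S -> K}).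

(** The form passes to a nonzero form on the values at the constants. *)
Definition root_form_of_kernel (w : E -> S) : Prop :=
  (exists e, ev (w e) != 0) /\ forall f, ev f = 0 -> ev (root_form w f) = 0.

(** If ev g is not zero although all root_form w (X^e g) vanish at ev, then
    root_form w (s g) vanishes for every s; s = g^(p-1) X^e gives
    g * root_form w X^e = g * w e, against the choice of w. *)
Lemma zero_test w g : root_form_of_kernel w ->
  ev g = 0 <-> forall e, ev (root_form w ('x^e * g)) = 0.
Proof.
move=> [[e0 we0] wker]; split=> [g0 e|H].
  by apply: wker; rewrite rmorphM g0 mulr0.
have Hs s : ev (root_form w (s * g)) = 0.
  rewrite (component_sum pF F_expp s) mulr_suml root_form_sum rmorph_sum big1 // => e _.
  by rewrite -mulrA root_form_expp rmorphM H mulr0.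
have := Hs (g ^+ p.-1 * 'x^e0).
rewrite mulrAC -exprSr prednK ?prime_gt0 // root_form_expp root_form_digit rmorphM.
by move/eqP; rewrite mulf_eq0 (negbTE we0) orbF => /eqP.
Qed.

(** As root_form w (s^p h) = s root_form w h, it suffices to test the multiples
    of the generators by monomials with exponents below p. *)
Lemma root_form_of_ideal w (gs : seq S) :
  (exists e, ev (w e) != 0) ->
  (forall f, ev f = 0 <-> in_ideal gs f) ->
  (forall j e, ev (root_form w ('x^e * gs`_j)) = 0) ->
  root_form_of_kernel w.
Proof.
move=> w0 gsP H; split=> // f /gsP[q ->]; rewrite root_form_sum rmorph_sum big1 // => j _.
rewrite (component_sum pF F_expp (q j)) mulr_suml root_form_sum rmorph_sum big1 // => e _.
by rewrite -mulrA root_form_expp rmorphM H mulr0.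
Qed.

(** A k-by-k minor of the matrix of components of members of H that does not
    vanish at the constants. *)
Definition independent (H : S -> Prop) (k : nat) : Prop :=
  exists (f : 'I_k -> S) (g : 'I_k -> E),
    [/\ injective g, forall i, H (f i) &
        ev (\det (\matrix_(i, j) component (g j) (f i))) != 0].

Lemma independent_bound H k : independent H k -> (k <= #|E|)%N.
Proof. by case=> f [g [gI _ _]]; have := leq_card g gI; rewrite card_ord. Qed.

(** The relation f(c) = 0 says that the values of X^e at c are killed by the
    p-th powers of the values of the components of f; as X^0 has value 1, the
    components cannot be independent. *)
Lemma independent_not_onto (H : S -> Prop) k (f : 'I_k -> S) (g : 'I_k -> E) :
  (forall h, H h -> ev h = 0) ->
  injective g -> (forall i, H (f i)) ->
  ev (\det (\matrix_(i, j) component (g j) (f i))) != 0 ->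
  exists e, e \notin codom g.
Proof.
move=> Hev gI Hf nz; apply/existsP; apply: contraT.
rewrite negb_exists => /forallP gsurj.
pose A := map_mx ev (\matrix_(i, j) component (g j) (f i)).
have pK : p \in [pchar K].
  by rewrite inE p_pr -(rmorph_nat ev) pcharf0 ?rmorph0 ?eqxx //; exact: pchar_mpoly.
pose B := map_mx (pFrobenius_aut pK) A.
pose v : 'cV_k := \col_j ev 'x^(g j).
have Bv : B *m v = 0.
  apply/matrixP => i j; rewrite !mxE -[RHS](Hev _ (Hf i)).
  rewrite (component_sum pF F_expp (f i)) rmorph_sum (reindex g) /=; last first.
    apply: onW_bij; apply: inj_card_bij => //.
    rewrite -(card_codom gI); apply/subset_leq_card/subsetP => e _.
    by have := gsurj e; rewrite negbK.
  by apply: eq_bigr => j' _; rewrite !mxE rmorphM rmorphXn pFrobenius_autE.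
have Bu : B \in unitmx.
  rewrite unitmxE unitfE !det_map_mx;  rewrite fmorph_eq0; exact: nz.
have v0 : v = 0 by rewrite -(mulKmx Bu v) Bv mulmx0.
pose e0 : E := [ffun=> Ordinal (prime_gt0 p_pr)].
have /codomP[j0 ej0] : e0 \in codom g by have := gsurj e0; rewrite negbK.
have : v j0 0 = 1.
  rewrite mxE -ej0 -(rmorph1 ev) -mpolyX0; congr (ev 'X_[_]).
  by apply/mnmP => i; rewrite !mnmE ffunE.
by rewrite v0 mxE => /esym/eqP; rewrite oner_eq0.
Qed.

(** Choose a nonsingular matrix of maximal size k, add the row of the components
    of h and a column e; the determinant of the larger matrix vanishes for
    every h in H, and its expansion along the new row is the linear form
    sought. *)
Lemma root_form_exists (H : S -> Prop) :
  (forall h, H h -> ev h = 0) ->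
  exists w : E -> S,
    [/\ exists e, ev (w e) != 0,
        forall h, H h -> ev (root_form w h) = 0 &
        forall d, (forall h, H h -> deg_le d h) -> forall e, deg_le (p ^ m * d) (w e)].
Proof.
move=> Hev; apply: NNPP => now.
suff indep k : independent H k.
  by have := independent_bound (indep #|E|.+1); rewrite ltnn.
elim: k => [|k [f [g [gI Hf nz]]]].
  (* The empty minor is 1. *)
  exists (fun i : 'I_0 => 0), (fun i : 'I_0 => [ffun=> Ordinal (prime_gt0 p_pr)]).
  by split; [case | case | rewrite det_mx00 rmorph1 oner_eq0].
have [e0 e0g] := independent_not_onto Hev gI Hf nz.
have kE : (k <= p ^ m)%N.
  by have := leq_card g gI; rewrite card_ord card_ffun !card_ord.
pose gg (j : 'I_k.+1) := oapp g e0 (unlift ord0 j).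
pose ff h (i : 'I_k.+1) := oapp f h (unlift ord0 i).
have ggI : injective gg.
  move=> i j; rewrite /gg; case: (unliftP ord0 i) => [i'|] {i}->;
    case: (unliftP ord0 j) => [j'|] {j}-> //=;
    rewrite ?liftK ?unlift_none /=.
  - by move/gI ->.
  - by move=> E1; case/negP: e0g; rewrite -E1 codom_f.
  - by move=> E1; case/negP: e0g; rewrite E1 codom_f.
pose A h := \matrix_(i, j) component (gg j) (ff h i).
pose cof j := cofactor (A 0) ord0 j.
have cofE h j : cofactor (A h) ord0 j = cof j.
  rewrite /cof /cofactor; congr (_ * \det _); apply/matrixP => i i'.
  by rewrite !mxE /ff liftK.
pose w e := \sum_(j | gg j == e) cof j.
have wA h : root_form w h = \det (A h).
  rewrite (expand_det_row _ ord0) /root_form.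
  under eq_bigr do rewrite mulr_suml.
  rewrite (exchange_big_dep xpredT) //=; apply: eq_bigr => j _.
  rewrite (big_pred1 (gg j)) => [|e]; last by rewrite eq_sym.
  by rewrite cofE mulrC mxE /ff unlift_none.
apply: NNPP => noind; apply: now; exists w; split.
- exists e0; rewrite /w (big_pred1 ord0) => [|j]; last first.
    by rewrite -[e0]/(oapp g e0 None) -(@unlift_none _ ord0) (inj_eq ggI).
  rewrite /cof /cofactor addn0 expr0 mul1r.
  congr (ev (\det _) != 0): nz; apply/matrixP => i j.
  by rewrite !mxE /gg /ff !liftK.
- move=> h Hh; apply: NNPP => /eqP nzh; apply: noind.
  exists (ff h), gg; split=> //; last by rewrite -wA.
  by move=> i; rewrite /ff; case: unliftP => [i'|] _ /=.
- move=> d Hd e; apply: (filt_sum (deg_le_filtration _ _)) => j _.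
  apply: (filt_sign (deg_le_filtration _ _)).
  apply: (filtW (deg_le_filtration _ _) (k := (k * d)%N)).
    by rewrite leq_mul2r kE orbT.
  apply: (filt_det (deg_le_filtration _ _)) => i i'; rewrite !mxE.
  rewrite /ff liftK /=; apply: (filtW (deg_le_filtration _ _) (leq_div d p)).
  by apply: deg_le_component => //; apply: Hd.
Qed.

End ZeroTest.

(** * Finitely many states *)

Lemma card_bmultinom_le m k : #|{: 'X_{1..m < k}}| <= k ^ m.
Proof.
have lt_k (u : 'X_{1..m < k}) i : u i < k.
  by apply: leq_ltn_trans (bmdeg u); rewrite mdegE (bigD1 i) //= leq_addr.
pose f (u : 'X_{1..m < k}) : {ffun 'I_m -> 'I_k} := [ffun i => Ordinal (lt_k u i)].
have fI : injective f.
  move=> u v /ffunP E; apply/val_inj/mnmP => i.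
  by have := E i; rewrite !ffunE => /(congr1 val).
by have := leq_card f fI; rewrite card_ffun !card_ord.
Qed.

Section FiniteState.
Local Open Scope ring_scope.
Variables (p m t : nat) (F : finFieldType).
Hypotheses (pF : p \in [pchar F]) (F_expp : forall x : F, x ^+ p = x).
Local Notation S := {mpoly F[m]}.
Local Notation E := {ffun 'I_m -> 'I_p}.
Variables (K : fieldType) (ev : {rmorphism S -> K}).
Variables (w : E -> S) (W : nat).
Hypotheses (w_ker : root_form_of_kernel ev w) (w_deg : forall e, deg_le W (w e)).

Let p_pr : prime p.
Proof. exact: pcharf_prime pF. Qed.

Variables (L : finType) (Y : L -> ('I_t -> nat) -> S) (T : letter p t -> L -> L -> S).
Hypothesis Y_rec : forall n n' (a : letter p t), (forall k, n' k = p * n k + a k)%N ->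
  forall l, Y l n' = \sum_l' T a l l' * Y l' n ^+ p.
Variables (J : finType) (f0 : J -> letter p t -> L -> S).
Variables (mu beta0 : nat).
Hypotheses (T_deg : forall a l l', deg_le mu (T a l l'))
  (f0_deg : forall j a l, deg_le beta0 (f0 j a l)).

(** A digit step takes forms of degree beta to forms of degree at most
    W + (m p + beta + mu) / p, which is at most beta for this choice. *)
Definition degree_bound : nat := 2 * (W + m) + mu + beta0.
Local Notation beta := degree_bound.

Lemma degree_boundP : (W + (m * p + (beta + mu)) %/ p <= beta)%N.
Proof.
have p1 := prime_gt1 p_pr; rewrite divnMDl ?prime_gt0 //.
have := leq_div2l (beta + mu) (ltn0Sn 1) p1.
by rewrite /beta; lia.
Qed.

Local Notation coefs := {ffun 'X_{1..m < beta.+1} -> F}.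
Definition pol (g : coefs) : S := \sum_u g u *: 'X_[u].
Definition coefs_of (f : S) : coefs := [ffun u : 'X_{1..m < beta.+1} => f@_u].

Lemma coefs_ofK f : deg_le beta f -> pol (coefs_of f) = f.
Proof.
move=> fb; rewrite [RHS](mpolywE fb); apply: eq_bigr => u _.
by rewrite ffunE.
Qed.

Lemma deg_le_pol g : deg_le beta (pol g).
Proof.
apply: (filt_sum (deg_le_filtration _ _)) => u _; apply: deg_leZ; apply: deg_leX.
by have := bmdeg u; rewrite ltnS.
Qed.

Local Notation form := {ffun L -> coefs}.

Definition form_val (f : L -> S) (n : 'I_t -> nat) : K := ev (\sum_l f l * Y l n).

Definition form_digit (e : E) (a : letter p t) (f : L -> S) (l' : L) : S :=
  root_form w ('X_[digit_mnm e] * \sum_l f l * T a l l').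

Lemma form_digitP f n n' (a : letter p t) : (forall k, n' k = p * n k + a k)%N ->
  form_val f n' = 0 <-> forall e, form_val (form_digit e a f) n = 0.
Proof.
move=> nn'; rewrite /form_val (zero_test pF F_expp _ w_ker).
suff E1 e : root_form w ('X_[digit_mnm e] * \sum_l f l * Y l n') =
    \sum_l form_digit e a f l * Y l n.
  by split=> H e; have := H e; rewrite E1.
under eq_bigr do rewrite (Y_rec nn') mulr_sumr.
rewrite exchange_big /= mulr_sumr root_form_sum; apply: eq_bigr => l' _.
rewrite [RHS]mulrC -(root_form_expp pF F_expp) mulrCA; congr (root_form w (_ * _)).
by rewrite mulr_sumr; apply: eq_bigr => l _; rewrite mulrA mulrC.
Qed.

Lemma form_digit_deg e a f : (forall l, deg_le beta (f l)) ->
  forall l, deg_le beta (form_digit e a f l).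
Proof.
move=> fb l; apply: (filtW (deg_le_filtration _ _) degree_boundP).
apply: (deg_le_root_form pF) => //.
apply: (filtM (deg_le_filtration _ _)); first exact: deg_le_digit.
by apply: (filt_sum (deg_le_filtration _ _)) => i _; apply: (filtM (deg_le_filtration _ _)).
Qed.

Local Notation form_of f := ([ffun l => coefs_of (f l)] : form).

Definition zeros (n : 'I_t -> nat) : {set form} :=
  [set f : form | form_val (fun l => pol (f l)) n == 0].

Lemma form_of_zeros f n : (forall l, deg_le beta (f l)) ->
  (form_of f \in zeros n) = (form_val f n == 0).
Proof.
move=> fb; rewrite inE /form_val.
by under eq_bigr do rewrite ffunE coefs_ofK //.
Qed.

Definition last_letter (u : seq (letter p t)) : letter p t :=
  [ffun k => Ordinal (ltn_pmod (phi u k) (prime_gt0 p_pr))].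

(** The zero set of the forms after a word determines the zero set after any
    extension of the word by a letter, so it can serve as the state of an
    automaton that reads the highest digits first. *)
Lemma finite_state : exists (X : finType) (x0 : X) (step : X -> letter p t -> X)
    (accept : X -> bool),
  (#|X| <= 2 ^ ((#|F| ^ (beta.+1 ^ m)) ^ #|L|) * p ^ t)%N /\
  forall u, accept (foldl step x0 u) =
    [forall j, form_val (f0 j (last_letter u)) (phi u) == 0].
Proof.
pose X := ({set form} * letter p t)%type.
pose step (x : X) (a : letter p t) : X :=
  ([set f : form | [forall e, form_of (form_digit e a (fun l => pol (f l))) \in x.1]], a).
pose x0 : X := (zeros (phi ([::] : seq (letter p t))), last_letter [::]).
pose accept (x : X) := [forall j, form_of (f0 j x.2) \in x.1].
exists X, x0, step, accept; split.
  rewrite card_prod card_ffun !card_ord leq_mul2r; apply/orP; right.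
  rewrite -[X in (X <= _)%N]cardsT -powersetT card_powerset cardsT.
  rewrite leq_exp2l // card_ffun.
  case: (posnP #|L|) => [->|L0]; first by rewrite !expn0.
  rewrite leq_exp2r // card_ffun leq_pexp2l ?card_bmultinom_le //.
  by apply/card_gt0P; exists 0.
move=> u; have -> : foldl step x0 u = (zeros (phi u), last_letter u).
  elim/last_ind: u => // u a IH; rewrite foldl_rcons IH /step /=.
  have phiE k : phi (rcons u a) k = (p * phi u k + a k)%N by rewrite /phi foldl_rcons.
  congr (_, _); last first.
    apply/ffunP => k; rewrite ffunE; apply/val_inj => /=.
    by rewrite phiE mulnC modnMDl modn_small.
  apply/setP => f; rewrite !inE; apply/forallP/eqP => [H|/(form_digitP _ phiE) H e].
    apply/(form_digitP _ phiE) => e; have := H e; rewrite form_of_zeros; first by move/eqP.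
    by apply: form_digit_deg => l; exact: deg_le_pol.
  rewrite form_of_zeros; first by rewrite H.
  by apply: form_digit_deg => l; exact: deg_le_pol.
rewrite /accept /=; apply: eq_forallb => j; rewrite form_of_zeros // => l.
by apply: (filtW (deg_le_filtration _ _)) (f0_deg _ _ _); rewrite leq_addl.
Qed.

End FiniteState.

(** * Powers of a matrix and the Frobenius map *)

Section PowersModulo.
Local Open Scope ring_scope.
Variables (R : comNzRingType) (d : nat) (chi : {poly R}).
Hypotheses (chi_monic : chi \is monic) (chi_size : size chi = d.+2).

(** The remainder of X^n modulo chi; the recursion shows how the coefficients
    grow with n. *)
Fixpoint xpow n : {poly R} :=
  if n is n'.+1 then 'X * xpow n' - (xpow n')`_d *: chi else 1.

Lemma size_xpow n : (size (xpow n) <= d.+1)%N.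
Proof.
elim: n => [|n IH] /=; first by rewrite size_poly1.
apply/leq_sizeP => i di; rewrite coefB coefZ coefXM.
case: i di => // i di /=; move: di; rewrite ltnS leq_eqVlt => /orP[/eqP<-|di].
  by have := monicP chi_monic; rewrite lead_coefE chi_size /= => ->; rewrite mulr1 subrr.
rewrite (nth_default _ (leq_trans IH di)) [chi`_ _]nth_default ?mulr0 ?subrr //.
by rewrite chi_size.
Qed.

Definition congruent (f g : {poly R}) : Prop := exists q, f = q * chi + g.

Lemma congruentD f g f' g' : congruent f g -> congruent f' g' -> congruent (f + f') (g + g').
Proof. by move=> [q ->] [q' ->]; exists (q + q'); rewrite mulrDl addrACA. Qed.

Lemma congruentM f g h : congruent f g -> congruent (h * f) (h * g).
Proof. by move=> [q ->]; exists (h * q); rewrite mulrDr mulrA. Qed.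

Lemma congruent_trans f g h : congruent f g -> congruent g h -> congruent f h.
Proof. by move=> [q ->] [q' ->]; exists (q + q'); rewrite mulrDl addrA. Qed.

Lemma congruent_sum n (f g : 'I_n -> {poly R}) :
  (forall i, congruent (f i) (g i)) -> congruent (\sum_i f i) (\sum_i g i).
Proof.
move=> fg; elim/big_rec2: _ => [|i y1 y2 _]; first by exists 0; rewrite mul0r add0r.
exact: congruentD.
Qed.

Lemma congruent_xpow n : congruent 'X^n (xpow n).
Proof.
elim: n => [|n [q IH]]; first by exists 0; rewrite mul0r add0r.
exists ('X * q + ((xpow n)`_d)%:P); rewrite exprS IH mulrDr mulrA mulrDl -!addrA.
by congr (_ + _); rewrite /= mul_polyC addrC addrNK.
Qed.

Lemma congruent_uniq f g g' : congruent f g -> congruent f g' ->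
  (size g <= d.+1)%N -> (size g' <= d.+1)%N -> g = g'.
Proof.
move=> [q fg] [q' fg'] sg sg'.
have E1 : g - g' = (q' - q) * chi.
  have -> : (q' - q) * chi = (f - g') - (f - g).
    by rewrite {1}fg' fg !addrK mulrBl.
  by rewrite opprB [RHS]addrC addrA subrK.
have [q0|nq] := eqVneq (q' - q) 0.
  by apply/eqP; rewrite -subr_eq0 E1 q0 mul0r.
have := size_Mmonic nq chi_monic; rewrite -E1 chi_size addnS /= => s1.
have : (size (g - g')%R <= d.+1)%N by rewrite (leq_trans (size_polyD _ _)) // size_polyN geq_max sg.
by rewrite s1 -[X in (_ <= X)%N]add0n leq_add2r leqn0 size_poly_eq0 (negbTE nq).
Qed.

Variable p : nat.
Hypothesis pR : p \in [pchar R].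

(** Modulo chi, X^(p n + r) = X^r (X^n)^p, and p-th powers are additive. *)
Lemma xpow_Frobenius n r :
  xpow (p * n + r) = \sum_(l < d.+1) (xpow n)`_l ^+ p *: xpow (r + p * l).
Proof.
have pP : p \in [pchar {poly R}].
  by rewrite inE (pcharf_prime pR) -polyC_natr pcharf0 // polyC0 eqxx.
apply: (@congruent_uniq 'X^(p * n + r)); first exact: congruent_xpow; first last.
- rewrite (leq_trans (size_sum _ _ _)) //; apply/bigmax_leqP => l _.
  by rewrite (leq_trans (size_scale_leq _ _)) // size_xpow.
- exact: size_xpow.
have xE : xpow n = \sum_(l < d.+1) (xpow n)`_l *: 'X^l.
  rewrite -poly_def; apply/polyP => i; rewrite coef_poly.
  by case: ltnP => // di; rewrite nth_default // (leq_trans (size_xpow n)).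
apply: (@congruent_trans _ ('X^r * xpow n ^+ p)).
  rewrite exprD mulrC; apply: congruentM; rewrite mulnC exprM.
  have [q ->] := congruent_xpow n.
  rewrite -!(pFrobenius_autE pP) rmorphD rmorphM.
  by exists (pFrobenius_aut pP q * chi ^+ p.-1);
    rewrite -mulrA -exprSr prednK ?(prime_gt0 (pcharf_prime pR)) // -(pFrobenius_autE pP).
rewrite {1}xE -(pFrobenius_autE pP) rmorph_sum mulr_sumr.
apply: congruent_sum => l.
rewrite -[X in _ * X]/(_ ^+ p) exprZn -scalerAr -exprM -exprD mulnC -!mul_polyC.
by apply: congruentM; exact: congruent_xpow.
Qed.

Variables (D : nat -> R -> Prop) (FD : filtration D) (k : nat).
Hypothesis chi_filt : coef_filt D k chi.

Lemma xpow_filt n : coef_filt D (n * k) (xpow n).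
Proof.
elim: n => [|n IH] /=; first exact: (filt1 (coef_filtration FD)).
apply: (filtD (coef_filtration FD)).
  move=> i; rewrite coefXM; case: (i == 0%N); first exact: (filt0 FD).
  by apply: (filtW FD _ (IH _)); rewrite mulSn leq_addl.
apply: (filtN (coef_filtration FD)) => i; rewrite coefZ mulSn addnC.
exact: (filtM FD).
Qed.

End PowersModulo.

(** Cayley-Hamilton. *)
Lemma exp_char_poly (R : comNzRingType) (d : nat) (A : 'M[R]_d.+1) (n : nat) :
  (A ^+ n = \sum_(l < d.+1) (xpow d (char_poly A) n)`_l *: A ^+ l)%R.
Proof.
have chiP := char_poly_monic A; have chiS := size_char_poly A.
have [q /(congr1 (horner_mx A))] := congruent_xpow d (char_poly A) n.
rewrite rmorphXn /= horner_mx_X rmorphD rmorphM /= Cayley_Hamilton mulr0 add0r => ->.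
set f := xpow _ _ _; have -> : f = (\sum_(l < d.+1) f`_l *: 'X^l)%R.
  rewrite -poly_def; apply/polyP => i; rewrite coef_poly.
  by case: ltnP => // di; rewrite nth_default // (leq_trans (size_xpow chiP chiS n)).
rewrite rmorph_sum; apply: eq_bigr => l _.
rewrite /= horner_mxZ rmorphXn /= horner_mx_X coef_sum.
congr (_ *: _)%R; rewrite (bigD1 l) //= coefZ coefXn eqxx mulr1 big1 ?addr0 // => i ne.
by rewrite coefZ coefXn eq_sym (inj_eq val_inj) (negbTE ne) mulr0.
Qed.

(** * Exponential systems over polynomials *)

(** A form has s r (d+1)^t coefficients; the polynomials of degree
    at most the degree bound have at most (bound + 1)^m coefficients in F_p; a
    state is a set of forms together with the last letter. *)
Definition state_bound (p m d t s r delta W : nat) : nat :=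
  2 ^ ((p ^ ((degree_bound m W (t * (p * d.+1 * (d.+1 * delta)))
                (delta + (delta + t * (d.+1 * delta + delta)))).+1 ^ m))
       ^ (s * r * d.+1 ^ t)) * p ^ t.

Section PolynomialSystem.
Local Open Scope ring_scope.
Variables (p m d t s r : nat) (F : finFieldType).
Hypotheses (pF : p \in [pchar F]) (F_expp : forall x : F, x ^+ p = x) (cardF : #|F| = p).
Local Notation S := {mpoly F[m]}.
Local Notation E := {ffun 'I_m -> 'I_p}.
Variables (K : fieldType) (ev : {rmorphism S -> K}).
Variables (w : E -> S) (W : nat).
Hypotheses (w_ker : root_form_of_kernel ev w) (w_deg : forall e, deg_le W (w e)).

Variables (Q : 'I_s -> 'I_r -> letter p t -> S).
Variables (B : 'I_s -> 'I_r -> 'I_t.+1 -> 'M[S]_d.+1) (A : 'I_s -> 'I_r -> 'I_t -> 'M[S]_d.+1).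
Variable delta : nat.
Hypotheses (Q_deg : forall i j a, deg_le delta (Q i j a))
  (B_deg : forall i j k x y, deg_le delta (B i j k x y))
  (A_deg : forall i j k x y, deg_le delta (A i j k x y)).

Let FD := deg_le_filtration F m.
Let p_pr : prime p.
Proof. exact: pcharf_prime pF. Qed.

Definition exp_term i j (n : 'I_t -> nat) : 'M[S]_d.+1 :=
  B i j ord0 * \prod_(k < t) (A i j k ^+ n k * B i j (lift ord0 k)).

Local Notation ix := ('I_s * 'I_r * {ffun 'I_t -> 'I_d.+1})%type.
Local Notation chi i j k := (char_poly (A i j k)).

(** Coordinates of products of matrix powers with respect to products of powers
    with exponents at most d. *)
Definition power_coef (l : ix) (n : 'I_t -> nat) : S :=
  \prod_(k < t) (xpow d (chi l.1.1 l.1.2 k) (n k))`_(l.2 k).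

Definition power_trans (a : letter p t) (l l' : ix) : S :=
  if l.1 == l'.1
  then \prod_(k < t) (xpow d (chi l.1.1 l.1.2 k) (a k + p * l'.2 k)%N)`_(l.2 k)
  else 0.

Lemma power_coef_rec n n' (a : letter p t) : (forall k, n' k = p * n k + a k)%N ->
  forall l, power_coef l n' = \sum_l' power_trans a l l' * power_coef l' n ^+ p.
Proof.
move=> nn' [[i j] l]; rewrite /power_coef /=.
rewrite -(pair_bigA _ (fun ij f => power_trans a (i, j, l) (ij, f) * power_coef (ij, f) n ^+ p)) /=.
rewrite (bigD1 (i, j)) //= [X in _ + X]big1 ?addr0 => [|ij ne]; last first.
  by apply: big1 => f _; rewrite /power_trans /= eq_sym (negbTE ne) mul0r.
under [LHS]eq_bigr => k _.
  rewrite nn' (xpow_Frobenius (char_poly_monic _) (size_char_poly _) (pchar_mpoly m pF)) coef_sum.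
  over.
rewrite bigA_distr_bigA /=; apply: eq_bigr => f _.
rewrite /power_trans eqxx /power_coef -prodrXl -big_split; apply: eq_bigr => k _.
by rewrite coefZ mulrC.
Qed.

Lemma power_trans_deg a l l' :
  deg_le (t * (p * d.+1 * (d.+1 * delta))) (power_trans a l l').
Proof.
rewrite /power_trans; case: ifP => _; last exact: (filt0 FD).
apply: (filt_prod_ord FD) => k.
have chi_deg : coef_filt (@deg_le F m) (d.+1 * delta) (chi l.1.1 l.1.2 k).
  by apply: (char_poly_filt FD).
apply: (filtW FD _ (xpow_filt d FD chi_deg _ _)).
rewrite leq_mul2r; apply/orP; right.
have := ltn_ord (a k); have := leq_ord (l'.2 k); rewrite mulnS.
by move=> ld ap; rewrite leq_add ?leq_mul2l ?ld ?orbT // ltnW.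
Qed.

Lemma exp_term_deg i j n : (forall k, n k <= d)%N ->
  mx_filt (@deg_le F m) (delta + t * (d.+1 * delta + delta)) (exp_term i j n).
Proof.
move=> nd; have MF := mx_filtration FD d.
apply: (filtM MF); first by move=> x y; exact: B_deg.
apply: (filt_prod_ord MF) => k; apply: (filtM MF); last by move=> x y; exact: B_deg.
apply: (filtW MF (k := (n k * delta)%N)); first by rewrite leq_mul2r (leq_trans (nd k)) ?orbT.
by apply: (filtX MF) => x y; exact: A_deg.
Qed.

Lemma exp_term_expand i j n :
  exp_term i j n =
  \sum_(l : {ffun 'I_t -> 'I_d.+1}) power_coef (i, j, l) n *: exp_term i j (fun k => l k).
Proof.
rewrite /exp_term; under eq_bigr => k _.
  rewrite exp_char_poly mulr_suml; over.
rewrite bigA_distr_bigA mulr_sumr; apply: eq_bigr => l _.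
rewrite scalerAr; congr (_ * _); rewrite -scaler_prod.
by apply: eq_bigr => k _; rewrite -scalerAl.
Qed.

(** The form whose value is the (x, y) entry of the j-th equation; the letter a
    holds the residues modulo p, on which the factors P_ij depend. *)
Definition start_form (jxy : 'I_r * 'I_d.+1 * 'I_d.+1) (a : letter p t) (l : ix) : S :=
  if l.1.2 == jxy.1.1
  then Q l.1.1 l.1.2 a * exp_term l.1.1 l.1.2 (fun k => l.2 k) jxy.1.2 jxy.2
  else 0.

Lemma start_form_deg jxy a l :
  deg_le (delta + (delta + t * (d.+1 * delta + delta))) (start_form jxy a l).
Proof.
rewrite /start_form; case: ifP => _; last exact: (filt0 FD).
by apply: (filtM FD) => //; apply: exp_term_deg => k; rewrite -ltnS.
Qed.

Lemma start_form_val j x y a n :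
  \sum_l start_form (j, x, y) a l * power_coef l n =
  \sum_i Q i j a * exp_term i j n x y.
Proof.
rewrite -(pair_bigA _ (fun ij f => start_form (j, x, y) a (ij, f) * power_coef (ij, f) n)) /=.
rewrite -(pair_bigA _ (fun i j' => \sum_f
  start_form (j, x, y) a ((i, j'), f) * power_coef ((i, j'), f) n)) /=.
apply: eq_bigr => i _; rewrite (bigD1 j) //= [X in _ + X]big1 ?addr0 => [|j' ne]; last first.
  by apply: big1 => f _; rewrite /start_form /= (negbTE ne) mul0r.
rewrite [in RHS]exp_term_expand summxE mulr_sumr; apply: eq_bigr => f _.
by rewrite /start_form /= eqxx [X in _ = _ * X]mxE mulrA mulrAC.
Qed.

Lemma polynomial_system_states : exists (X : finType) (x0 : X) (step : X -> letter p t -> X)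
    (accept : X -> bool),
  (#|X| <= state_bound p m d t s r delta W)%N /\
  forall u, accept (foldl step x0 u) =
    [forall j, forall x, forall y,
      ev (\sum_i Q i j (last_letter pF u) * exp_term i j (phi u) x y) == 0].
Proof.
have [X [x0 [step [accept [cardX HX]]]]] := finite_state pF F_expp w_ker w_deg
  power_coef_rec power_trans_deg start_form_deg.
exists X, x0, step, accept; split.
  by move: cardX; rewrite !card_prod card_ffun !card_ord cardF.
move=> u; rewrite HX; apply/forallP/forallP => [H j|H [[j x] y]].
  apply/forallP => x; apply/forallP => y; have := H (j, x, y).
  by rewrite /form_val start_form_val.
by rewrite /form_val start_form_val; have /forallP/(_ x)/forallP := H j.
Qed.

End PolynomialSystem.

(** * Specialization to finite fields *)

Lemma minimal_witness (T : Type) (size : T -> nat) (Q : T -> Prop) :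
  (exists x, Q x) -> exists2 x, Q x & forall y, Q y -> (size x <= size y)%N.
Proof.
case=> x; have [n] := ubnP (size x); elim: n x => // n IH x xn Qx.
case: (classic (exists2 y, Q y & (size y < size x)%N)) => [[y Qy yx]|H].
  by apply: (IH y) => //; apply: leq_trans yx _.
exists x => // y Qy; rewrite leqNgt; apply/negP => yx; apply: H; by exists y.
Qed.

Section Specialization.
Local Open Scope ring_scope.
Variables (A : idomainType) (K : fieldType) (ev : {rmorphism A -> K}) (c : K).
Local Notation lift := (map_poly ev).
Local Notation at_c f := ((lift f).[c]).

Lemma coef_kernel (Omega : fieldType) (ev' : {rmorphism A -> Omega}) f :
  (forall a, ev a = 0 -> ev' a = 0) -> lift f = 0 -> map_poly ev' f = 0.
Proof.
move=> H /polyP f0; apply/polyP => i; rewrite coef0 coef_map; apply: H.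
by have := f0 i; rewrite coef_map coef0.
Qed.

(** A leading term that vanishes at ev could be dropped. *)
Lemma lead_coef_minimal (Q : {poly A} -> Prop) r :
  (forall f g, Q f -> lift g = 0 -> Q (f - g)) ->
  Q r -> lift r != 0 ->
  (forall f, Q f -> lift f != 0 -> (size r <= size f)%N) ->
  ev (lead_coef r) != 0.
Proof.
move=> QB Qr nr Hmin; apply/eqP => l0.
have rpos : (0 < size r)%N.
  by rewrite size_poly_gt0; apply: contraNneq nr => ->; rewrite rmorph0.
have t0 : lift (lead_coef r *: 'X^((size r).-1)) = 0 by rewrite map_polyZ l0 scale0r.
have := Hmin _ (QB _ _ Qr t0); rewrite rmorphB /= t0 subr0 => /(_ nr).
rewrite leqNgt => /negP; apply.
rewrite -[X in (_ < X)%N](prednK rpos) ltnS; apply/leq_sizeP => i.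
rewrite leq_eqVlt coefB coefZ coefXn.
case/orP => [/eqP <-|lti]; first by rewrite eqxx mulr1 lead_coefE subrr.
by rewrite (gtn_eqF lti) mulr0 subr0 nth_default // -(prednK rpos).
Qed.

(** If c is transcendental over the values of A, take for alpha a coefficient
    of f.  Otherwise let g be of minimal size among the nonzero relations
    satisfied by c; as f does not vanish at c, it is coprime to g over the
    fraction field, so some combination of f and g is a constant beta, and
    alpha is beta times the leading coefficient of g. *)
Lemma extend_specialization (f : {poly A}) : at_c f != 0 ->
  exists2 alpha, ev alpha != 0 &
    forall (Omega : closedFieldType) (ev' : {rmorphism A -> Omega}),
      (forall a, ev a = 0 -> ev' a = 0) -> ev' alpha != 0 ->
      exists2 xi, (map_poly ev' f).[xi] != 0 &
        forall h, at_c h = 0 -> (map_poly ev' h).[xi] = 0.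
Proof.
move=> fc; case: (classic (exists g, at_c g = 0 /\ lift g != 0)) => [exg|nog]; last first.
  have f0 : lead_coef (lift f) != 0.
    by rewrite lead_coef_eq0; apply: contraNneq fc => ->; rewrite horner0.
  exists f`_(size (lift f)).-1; first by rewrite -coef_map.
  move=> Omega ev' H a0.
  have /closed_nonrootP[xi xiP] : map_poly ev' f != 0.
    by apply: contraNneq a0 => /polyP/(_ (size (lift f)).-1); rewrite coef_map coef0 => ->.
  exists xi => // h hc; rewrite (coef_kernel H) ?horner0 //.
  by apply/eqP; apply: contra_notT nog => nh; exists h.
have [g [gc ng] gmin] := minimal_witness (fun g : {poly A} => size g) exg.
have lg : ev (lead_coef g) != 0.
  apply: (@lead_coef_minimal (fun h => at_c h = 0)) => //.
    by move=> h1 h2 h1c h2c; rewrite rmorphB /= h2c subr0.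
  by move=> h hc nh; exact: gmin.
pose Q r := exists u v z, [/\ r = u * f + v * g + z, lift z = 0 & True].
have Qg : Q g by exists 0, 1, 0; rewrite mul0r add0r mul1r addr0 rmorph0.
have Qf : Q f by exists 1, 0, 0; rewrite mul0r addr0 mul1r addr0 rmorph0.
have QB r1 r2 : Q r1 -> lift r2 = 0 -> Q (r1 - r2).
  move=> [u [v [z [-> z0 _]]]] r20; exists u, v, (z - r2); split=> //.
    by rewrite addrA.
  by rewrite rmorphB /= z0 r20 subr0.
have Qlin a r1 q r2 : Q r1 -> Q r2 -> Q (a *: r1 - q * r2).
  move=> [u [v [z [-> z0 _]]]] [u' [v' [z' [-> z0' _]]]].
  exists (a%:P * u - q * u'), (a%:P * v - q * v'), (a%:P * z - q * z'); split=> //.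
    by rewrite -mul_polyC; ring.
  by rewrite rmorphB !rmorphM /= z0 z0' !mulr0 subr0.
have [r [Qr nr] rmin] : exists2 r, Q r /\ lift r != 0 &
    forall y, Q y /\ lift y != 0 -> (size r <= size y)%N.
  by apply: minimal_witness; exists g.
have lr : ev (lead_coef r) != 0.
  by apply: (@lead_coef_minimal Q) => // h Qh nh; exact: rmin.
have r0 : r != 0 by apply: contraNneq nr => ->; rewrite rmorph0.
(* Members of the ideal are multiples of r up to a power of its leading
   coefficient and up to polynomials that vanish identically at ev. *)
have divr h : Q h -> exists n q z,
    [/\ lead_coef r ^+ n *: h = q * r + z, lift z = 0 & (size z < size r)%N].
  move=> Qh; exists (scalp h r), (h %/ r)%R, (h %% r)%R.
  split; [exact: Pdiv.Idomain.divp_eq| |by rewrite ltn_modp].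
  apply/eqP; apply: contraT => nz.
  have : Q (h %% r)%R.
    have -> : (h %% r)%R = lead_coef r ^+ scalp h r *: h - (h %/ r)%R * r.
      by rewrite Pdiv.Idomain.divp_eq addrC addKr.
    exact: Qlin.
  move=> Qz; have := rmin _ (conj Qz nz).
  by rewrite leqNgt ltn_modp r0.
have rc : at_c r != 0.
  have [n [q [z [E z0 _]]]] := divr _ Qf.
  have := congr1 (fun h => at_c h) E.
  rewrite /= rmorphD rmorphM /= z0 addr0 map_polyZ hornerZ hornerM rmorphXn => E1.
  apply: contraNneq (mulf_neq0 (expf_neq0 n lr) fc) => rc0.
  by rewrite E1 rc0 mulr0.
have sr : (size r <= 1)%N.
  have [n [q [z [E z0 sz]]]] := divr _ Qg.
  have E1 : lift q * lift r = ev (lead_coef r) ^+ n *: lift g.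
    by rewrite -rmorphXn -map_polyZ E rmorphD rmorphM /= z0 addr0.
  have nq : lift q != 0.
    apply: contraNneq (expf_neq0 n lr) => q0; move/eqP: E1.
    by rewrite q0 mul0r eq_sym scaler_eq0 (negbTE ng) orbF.
  have qc : at_c q = 0.
    have := congr1 (fun h => h.[c]) E1; rewrite /= hornerM hornerZ gc mulr0 => /eqP.
    by rewrite mulf_eq0 (negbTE rc) orbF => /eqP.
  have q0 : q != 0 by apply: contraNneq nq => ->; rewrite rmorph0.
  have : (size (q * r)%R <= size g)%N.
    have -> : q * r = lead_coef r ^+ n *: g - z by rewrite E addrK.
    rewrite (leq_trans (size_polyD _ _)) // size_polyN geq_max size_scale_leq.
    by rewrite (leq_trans (ltnW sz)) // rmin.
  rewrite size_mul // => sqr; have := gmin _ (conj qc nq).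
  by move: sqr q0; rewrite -size_poly_gt0; lia.
have rE := size1_polyC sr; have lrE : lead_coef r = r`_0 by rewrite rE lead_coefC coefC.
exists (lead_coef g * r`_0); first by rewrite rmorphM mulf_neq0 // -lrE.
move=> Omega ev' H; rewrite rmorphM mulf_eq0 negb_or => /andP[lg' r0'].
have sg : size (map_poly ev' g) = size g by apply: size_map_poly_id0.
have /closed_rootP[xi /rootP xiP] : size (map_poly ev' g) != 1%N.
  rewrite sg; apply: contraNneq ng => sg1.
  have gE : g = (g`_0)%:P by apply: size1_polyC; rewrite sg1.
  by move: gc; rewrite gE map_polyC hornerC /= => ->; rewrite polyC0.
exists xi => [|h hc].
  have [u [v [z [E z0 _]]]] := Qr.
  apply: contraNneq r0' => f0.
  have := congr1 (fun h => (map_poly ev' h).[xi]) E.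
  rewrite /= rE map_polyC hornerC !rmorphD !rmorphM /= (coef_kernel H z0) addr0.
  by rewrite hornerD !hornerM f0 xiP !mulr0 addr0 coefC /= => ->.
have g0 : g != 0 by apply: contraNneq ng => ->; rewrite rmorph0.
have E := Pdiv.Idomain.divp_eq h g.
have zc : at_c (h %% g)%R = 0.
  have := congr1 (fun h => at_c h) E.
  rewrite /= map_polyZ rmorphD rmorphM /= hornerD hornerZ hornerM hc gc !mulr0 add0r.
  by move=> <-.
have z0 : lift (h %% g)%R = 0.
  apply/eqP; apply: contraT => nz; have := gmin _ (conj zc nz).
  by rewrite leqNgt ltn_modp g0.
have := congr1 (fun h => (map_poly ev' h).[xi]) E.
rewrite /= map_polyZ rmorphD rmorphM /= (coef_kernel H z0) addr0 hornerZ hornerM xiP mulr0.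
move/eqP; rewrite rmorphXn mulf_eq0 expf_eq0 (negbTE lg') andbF /=.
by move/eqP.
Qed.

End Specialization.

Section Points.
Local Open Scope ring_scope.
Variables (F : fieldType) (K : fieldType) (Omega : closedFieldType).
Variables (toK : {rmorphism F -> K}) (toO : {rmorphism F -> Omega}).

(** Evaluation of the last variable after that of the others. *)
Lemma mmap_muni (R : fieldType) (toR : {rmorphism F -> R}) m (c : 'I_m.+1 -> R)
    (h : {mpoly F[m.+1]}) :
  mmap toR c h =
  (map_poly (mmap toR (fun i : 'I_m => c (widen_ord (leqnSn m) i))) (muni h)).[c ord_max].
Proof.
elim/mpoly_additive_ind: h => [|f g IHf IHg|a u].
- by rewrite mmap0 muni0 rmorph0 horner0.
- by rewrite mmapD IHf IHg muniD rmorphD hornerD.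
rewrite mmapZ mmapX muniZ map_polyZ hornerZ /= mmapC; congr (_ * _).
rewrite muniE msuppX big_seq1 mcoeffX eqxx scale1r map_polyZ map_polyXn hornerZ hornerXn.
rewrite /= mmapX /mmap1 big_ord_recr; congr (_ * _).
by apply: eq_bigr => i _; rewrite mnmE.
Qed.

(** The variables are specialized one by one. *)
Lemma point_exists m (c : 'I_m -> K) (f : {mpoly F[m]}) : mmap toK c f != 0 ->
  exists2 x : 'I_m -> Omega, mmap toO x f != 0 &
    forall h, mmap toK c h = 0 -> mmap toO x h = 0.
Proof.
elim: m c f => [|m IH] c f fc.
  exists (fun _ => 0).
    by move: fc; rewrite (nvar0_mpolyC f) !mmapC !fmorph_eq0.
  move=> h; rewrite {1}[h](nvar0_mpolyC h) mmapC => /eqP.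
  rewrite fmorph_eq0 => /eqP E; rewrite [h](nvar0_mpolyC h) mmapC E; exact: raddf0.
move: fc; rewrite mmap_muni => /extend_specialization[alpha /IH[x xa Hx]].
move/(_ _ (mmap toO x) Hx xa) => [xi fxi Hxi].
pose y (i : 'I_m.+1) := if insub (i : nat) is Some j then x j else xi.
have yE h : mmap toO y h = (map_poly (mmap toO x) (muni h)).[xi].
  rewrite mmap_muni; congr (_.[_]); last by rewrite /y insubF //= ltnn.
  apply: eq_map_poly => g; rewrite /mmap; apply: eq_bigr => u _; congr (_ * _).
  rewrite /mmap1; apply: eq_bigr => i _; congr (_ ^+ _).
  by rewrite /y insubT //= => ilt; congr x; apply/val_inj.
exists y; first by rewrite yE.
by move=> h; rewrite mmap_muni yE; exact: Hxi.
Qed.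

End Points.

Section FiniteOrder.
Local Open Scope ring_scope.
Variables (p : nat) (F : finFieldType) (pF : p \in [pchar F]).
Variables (Omega : fieldType) (toO : {rmorphism F -> Omega}).

Let pO : p \in [pchar Omega].
Proof. by rewrite (fmorph_pchar toO). Qed.

Lemma expp_iter (x : Omega) N k : x ^+ (p ^ N) = x -> x ^+ (p ^ (N * k)) = x.
Proof.
by move=> H; elim: k => [|k IH]; rewrite ?muln0 ?expr1 // mulnS expnD exprM H.
Qed.

(** The powers of x are values at x of polynomials of bounded degree over F,
    of which there are finitely many. *)
Lemma integral_finite_order (x : Omega) : integralOver toO x ->
  exists2 N, (0 < N)%N & x ^+ (p ^ N) = x.
Proof.
case=> q qm /rootP qx; pose n := size q.
pose f (k : 'I_(#|{: {ffun 'I_n -> F}}|).+1) : {ffun 'I_n -> F} :=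
  [ffun i : 'I_n => ('X^(p ^ k) %% q)`_i].
have : ~~ injectiveb f.
  apply/negP => /injectiveP fI; have := leq_card f fI.
  by rewrite card_ord ltnn.
case/injectivePn => i [j ij fij].
wlog lt_ij : i j ij fij / (i < j)%N.
  move=> H; case: (ltngtP i j) => [lt|lt|E]; first exact: (H i j).
    by apply: (H j i) => //; rewrite eq_sym.
  by case/eqP: ij; apply/val_inj.
have xE k : x ^+ (p ^ k) = (map_poly toO ('X^(p ^ k) %% q)).[x].
  have := divp_eq 'X^(p ^ k) q => /(congr1 (fun h => (map_poly toO h).[x])).
  by rewrite /= map_polyXn hornerXn rmorphD rmorphM hornerD hornerM qx mulr0 add0r.
have q0 : q != 0 by exact: monic_neq0.
have E : x ^+ (p ^ j) = x ^+ (p ^ i).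
  rewrite !xE; congr ((map_poly _ _).[_]); apply/polyP => k.
  case: (ltnP k n) => [kn|nk]; first by have /ffunP/(_ (Ordinal kn)) := fij; rewrite !ffunE.
  by rewrite !nth_default // (leq_trans _ nk) // ltnW // ltn_modp.
exists (j - i)%N; first by rewrite subn_gt0.
have iterE k (y : Omega) : y ^+ (p ^ k) = iter k (pFrobenius_aut pO) y.
  by elim: k => [|k IH]; rewrite ?expr1 // expnSr exprM IH.
have iterI k : injective (iter k (pFrobenius_aut pO)).
  by elim: k => // k IH y z /= /fmorph_inj /IH.
(* The Frobenius map is injective. *)
apply: (iterI i); rewrite -!iterE -exprM -expnD subnK ?(ltnW lt_ij) //.
Qed.

End FiniteOrder.

(** A form of the Nullstellensatz: the point is found over an algebraic closure of
    F, where every element has finite order under the Frobenius map. *)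
Lemma finite_point (p : nat) (K : fieldType) (m : nat) (F : finFieldType)
    (toK : {rmorphism F -> K}) (c : 'I_m -> K) (f : {mpoly F[m]}) :
  p \in [pchar F]%R -> (mmap toK c f != 0)%R ->
  exists (Omega : fieldType) (toO : {rmorphism F -> Omega}) (x : 'I_m -> Omega) (N : nat),
    [/\ 0 < N, forall i, (x i ^+ (p ^ N) = x i)%R, (mmap toO x f != 0)%R &
        forall h, (mmap toK c h = 0 -> mmap toO x h = 0)%R].
Proof.
move=> pF fc; have [Omega [toO toO_int]] := countable_algebraic_closure F.
have [x fx Hx] := @point_exists F K Omega toK toO m c f fc.
have {toO_int}/fin_all_exists2[N N0 HN] i := integral_finite_order pF (toO_int (x i)).
exists Omega, toO, x, (\prod_i N i); split=> //; first exact: prodn_gt0.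
by move=> i; rewrite (bigD1 i) //=; apply: expp_iter.
Qed.

(** * The algorithm on lists of numbers *)

(** A polynomial is a list of terms (exponents, coefficient), where missing
    exponents are 0 and the same exponents may occur several times. *)
Notation raw_poly := (seq (seq nat * nat)).
Notation raw_frac := (raw_poly * raw_poly)%type.
Notation raw_mx := (seq (seq raw_frac)).
(** The parameters p, m, d, t, s, r, the relations, the P_ij, the b_ijk and the
    a_ijk, in the order in which a description is encoded. *)
Notation raw_system := (seq nat * (seq raw_poly * (seq (seq (seq (seq nat * raw_frac))) *
  (seq (seq (seq raw_mx)) * seq (seq (seq raw_mx))))))%type.

Definition poly_mul (m : nat) (f g : raw_poly) : raw_poly :=
  [seq ([seq nth 0 x.1 i + nth 0 y.1 i | i <- iota 0 m], x.2 * y.2) | x <- f, y <- g].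

Definition frac_nat (k : nat) : raw_frac := ([:: ([::], k)], [:: ([::], 1)]).

Definition frac_add (m : nat) (q q' : raw_frac) : raw_frac :=
  (poly_mul m q.1 q'.2 ++ poly_mul m q'.1 q.2, poly_mul m q.2 q'.2).

Definition frac_mul (m : nat) (q q' : raw_frac) : raw_frac :=
  (poly_mul m q.1 q'.1, poly_mul m q.2 q'.2).

Definition frac_sum (m : nat) (qs : seq raw_frac) : raw_frac :=
  foldr (frac_add m) (frac_nat 0) qs.

Definition mx_entry (X : raw_mx) (x y : nat) : raw_frac := nth (frac_nat 0) (nth [::] X x) y.

Definition mx_mul (m n : nat) (X Y : raw_mx) : raw_mx :=
  [seq [seq frac_sum m [seq frac_mul m (mx_entry X x k) (mx_entry Y k y) | k <- iota 0 n]
       | y <- iota 0 n] | x <- iota 0 n].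

Definition mx_one (n : nat) : raw_mx :=
  [seq [seq (if x == y then frac_nat 1 else frac_nat 0) | y <- iota 0 n] | x <- iota 0 n].

Definition mx_pow (m n : nat) (X : raw_mx) (k : nat) : raw_mx :=
  iter k (mx_mul m n X) (mx_one n).

Section System.
Variable R : raw_system.

Definition sys_p := nth 0 R.1 0.
Definition sys_m := nth 0 R.1 1.
Definition sys_n := (nth 0 R.1 2).+1.
Definition sys_t := nth 0 R.1 3.
Definition sys_s := nth 0 R.1 4.
Definition sys_r := nth 0 R.1 5.
Definition sys_relations : seq raw_poly := R.2.1.
Definition sys_P i j : seq (seq nat * raw_frac) := nth [::] (nth [::] R.2.2.1 i) j.
Definition sys_b i j k : raw_mx := nth [::] (nth [::] (nth [::] R.2.2.2.1 i) j) k.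
Definition sys_a i j k : raw_mx := nth [::] (nth [::] (nth [::] R.2.2.2.2 i) j) k.

Definition monomial_value (n u : seq nat) : nat :=
  foldr muln 1 [seq nth 0 n k ^ nth 0 u k | k <- iota 0 sys_t].

Definition P_value i j (n : seq nat) : raw_frac :=
  frac_sum sys_m [seq frac_mul sys_m (frac_nat (monomial_value n x.1)) x.2 | x <- sys_P i j].

Definition term_value i j (n : seq nat) : raw_mx :=
  foldl (fun X k => mx_mul sys_m sys_n X
           (mx_mul sys_m sys_n (mx_pow sys_m sys_n (sys_a i j k) (nth 0 n k)) (sys_b i j k.+1)))
        (sys_b i j 0) (iota 0 sys_t).

Definition equation_value j x y (n : seq nat) : raw_frac :=
  frac_sum sys_m [seq frac_mul sys_m (P_value i j n) (mx_entry (term_value i j n) x y)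
                 | i <- iota 0 sys_s].

Definition word_value (u : seq (seq nat)) : seq nat :=
  [seq foldl (fun n a => sys_p * n + nth 0 a k) 0 u | k <- iota 0 sys_t].

Definition numerators (u : seq (seq nat)) : seq raw_poly :=
  [seq (equation_value jxy.1.1 jxy.1.2 jxy.2 (word_value u)).1
  | jxy <- [seq (jx, y) | jx <- [seq (j, x) | j <- iota 0 sys_r, x <- iota 0 sys_n],
                          y <- iota 0 sys_n]].

End System.

(** ** Ideal membership *)

(** Representative of an exponent modulo X^(k+1) = X if k is positive; the
    identity if k = 0. *)
Definition reduce (k e : nat) : nat := if e == 0 then 0 else (e.-1 %% k).+1.

Definition same_monomial (m k : nat) (u v : seq nat) : bool :=
  all (fun i => reduce k (nth 0 u i) == reduce k (nth 0 v i)) (iota 0 m).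

Definition is_zero (p m k : nat) (f : raw_poly) : bool :=
  all (fun x => sumn [seq y.2 | y <- f & same_monomial m k x.1 y.1] %% p == 0) f.

Definition poly_scale (c : nat) (f : raw_poly) : raw_poly := [seq (x.1, c * x.2) | x <- f].

(** Coefficients below p represent all of F_p. *)
Definition combinations (p : nat) (gs : seq raw_poly) : seq raw_poly :=
  foldr (fun g acc => [seq poly_scale c g ++ s | c <- iota 0 p, s <- acc]) [:: [::]] gs.

Definition multiples (m E : nat) (gs : seq raw_poly) : seq raw_poly :=
  [seq poly_mul m [:: (e, 1)] g | e <- box m E, g <- gs].

(** Membership in the ideal of gs with cofactors of exponents below E, modulo
    the polynomials X_i^(k+1) - X_i if k is positive. *)
Definition in_span (p m k E : nat) (gs : seq raw_poly) (f : raw_poly) : bool :=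
  has (fun s => is_zero p m k (f ++ s)) (combinations p (multiples m E gs)).

(** Membership is witnessed by a combination of the generators, non-membership by
    a larger ideal that still does not contain f. *)
Definition settled (p m N : nat) (gs : seq raw_poly) (f : raw_poly) : bool :=
  in_span p m 0 N gs f ||
  has (fun N' => ~~ in_span p m (p ^ N').-1 (p ^ N') gs f) (iota 1 N).

(** ** The bound on the number of states *)

Definition degree_poly (f : raw_poly) : nat := sumn [seq sumn x.1 | x <- f].
Definition degree_frac (q : raw_frac) : nat := degree_poly q.1 + degree_poly q.2.

Section Bound.
Variable R : raw_system.

Definition index_pairs (k l : nat) : seq (nat * nat) := [seq (x, y) | x <- iota 0 k, y <- iota 0 l].

Definition mx_fracs (X : raw_mx) : seq raw_frac :=
  [seq mx_entry X x.1 x.2 | x <- index_pairs (sys_n R) (sys_n R)].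

Definition sys_fracs : seq raw_frac :=
  flatten [seq [seq x.2 | x <- sys_P R i.1 i.2] ++
               flatten [seq mx_fracs (sys_b R i.1 i.2 k) | k <- iota 0 (sys_t R).+1] ++
               flatten [seq mx_fracs (sys_a R i.1 i.2 k) | k <- iota 0 (sys_t R)]
          | i <- index_pairs (sys_s R) (sys_r R)].

Definition sys_degree : nat := sumn [seq degree_frac q | q <- sys_fracs].

(** Bound on the degree of a form that preserves the ideal of relations: it
    consists of minors of size at most p^m of a matrix of components of the
    polynomials X^e g, with e below p and g a relation. *)
Definition form_degree : nat :=
  sys_p R ^ sys_m R * (sys_m R * sys_p R + sumn [seq degree_poly g | g <- sys_relations R]).

Definition sys_state_bound : nat :=
  state_bound (sys_p R) (sys_m R) (sys_n R).-1 (sys_t R) (sys_s R) (sys_r R)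
    sys_degree form_degree.

Definition test_length : nat := sys_state_bound * sys_state_bound.

End Bound.

(** ** The search *)

Definition holds_at (R : raw_system) (N : nat) (u : seq (seq nat)) : bool :=
  all (in_span (sys_p R) (sys_m R) 0 N (sys_relations R)) (numerators R u).

(** The test automaton compares words w a v and w' v with w, w' and v of length
    at most the test length. *)
Definition stage_settled (R : raw_system) (N : nat) : bool :=
  all (fun u => all (settled (sys_p R) (sys_m R) N (sys_relations R)) (numerators R u))
      (words (sys_p R) (sys_t R) (2 * test_length R).+1).

Definition stage_automaton (R : raw_system) (N : nat) : raw_automaton :=
  test_automaton (holds_at R N) (sys_p R) (sys_t R) (test_length R).

(** ** Computability of the search *)

Section ComputableArithmetic.
Context {E : Type} {EE : Enc E}.
Variables (m n p k : E -> nat) (f g : E -> raw_poly) (q q' : E -> raw_frac) (X Y : E -> raw_mx).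
Variables (u v : E -> seq nat) (gs : E -> seq raw_poly).
Hypotheses (Hm : computable m) (Hn : computable n) (Hp : computable p) (Hk : computable k)
  (Hf : computable f) (Hg : computable g) (Hq : computable q) (Hq' : computable q')
  (HX : computable X) (HY : computable Y) (Hu : computable u) (Hv : computable v)
  (Hgs : computable gs).

Lemma computable_poly_mul : computable (fun e => poly_mul (m e) (f e) (g e)).
Proof using Hm Hf Hg. by rewrite /poly_mul; computability. Qed.

Lemma computable_frac_nat : computable (fun e => frac_nat (n e)).
Proof using Hn. by rewrite /frac_nat; computability. Qed.

Lemma computable_reduce : computable (fun e => reduce (k e) (n e)).
Proof using Hn Hk. by rewrite /reduce; computability. Qed.

Lemma computable_poly_scale : computable (fun e => poly_scale (n e) (f e)).
Proof using Hn Hf. by rewrite /poly_scale; computability. Qed.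

Lemma computable_mx_entry : computable (fun e => mx_entry (X e) (m e) (n e)).
Proof using Hm Hn HX. by rewrite /mx_entry; computability. Qed.

Lemma computable_degree_poly : computable (fun e => degree_poly (f e)).
Proof using Hf. by rewrite /degree_poly; computability. Qed.

Lemma computable_index_pairs : computable (fun e => index_pairs (m e) (n e)).
Proof using Hm Hn. by rewrite /index_pairs; computability. Qed.

End ComputableArithmetic.

Ltac computable_poly :=
  lazymatch goal with
  | |- computable (fun _ => poly_mul _ _ _) => apply: computable_poly_mul
  | |- computable (fun _ => frac_nat _) => apply: computable_frac_nat
  | |- computable (fun _ => reduce _ _) => apply: computable_reduce
  | |- computable (fun _ => poly_scale _ _) => apply: computable_poly_scale
  | |- computable (fun _ => mx_entry _ _ _) => apply: computable_mx_entry
  | |- computable (fun _ => degree_poly _) => apply: computable_degree_poly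
  | |- computable (fun _ => index_pairs _ _) => apply: computable_index_pairs
  | _ => computable_word
  end.
Ltac computable_hook ::= computable_poly.

Section ComputableArithmetic2.
Context {E : Type} {EE : Enc E}.
Variables (m n p k l : E -> nat) (f : E -> raw_poly) (q q' : E -> raw_frac) (X Y : E -> raw_mx).
Variables (u v : E -> seq nat) (gs : E -> seq raw_poly) (qs : E -> seq raw_frac).
Hypotheses (Hm : computable m) (Hn : computable n) (Hp : computable p) (Hk : computable k)
  (Hl : computable l) (Hf : computable f) (Hq : computable q) (Hq' : computable q')
  (HX : computable X) (HY : computable Y) (Hu : computable u) (Hv : computable v)
  (Hgs : computable gs) (Hqs : computable qs).

Lemma computable_frac_mul : computable (fun e => frac_mul (m e) (q e) (q' e)).
Proof using Hm Hq Hq'. by rewrite /frac_mul; computability. Qed.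

Lemma computable_frac_sum : computable (fun e => frac_sum (m e) (qs e)).
Proof using Hm Hqs. by rewrite /frac_sum /frac_add; computability. Qed.

Lemma computable_mx_one : computable (fun e => mx_one (n e)).
Proof using Hn. by rewrite /mx_one; computability. Qed.

Lemma computable_is_zero : computable (fun e => is_zero (p e) (m e) (k e) (f e)).
Proof using Hp Hm Hk Hf. by rewrite /is_zero /same_monomial; computability. Qed.

Lemma computable_combinations : computable (fun e => combinations (p e) (gs e)).
Proof using Hp Hgs. by rewrite /combinations; computability. Qed.

Lemma computable_multiples : computable (fun e => multiples (m e) (n e) (gs e)).
Proof using Hm Hn Hgs. by rewrite /multiples; computability. Qed.

Lemma computable_degree_frac : computable (fun e => degree_frac (q e)).
Proof using Hq. by rewrite /degree_frac; computability. Qed.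

End ComputableArithmetic2.

Ltac computable_frac :=
  lazymatch goal with
  | |- computable (fun _ => frac_mul _ _ _) => apply: computable_frac_mul
  | |- computable (fun _ => frac_sum _ _) => apply: computable_frac_sum
  | |- computable (fun _ => mx_one _) => apply: computable_mx_one
  | |- computable (fun _ => is_zero _ _ _ _) => apply: computable_is_zero
  | |- computable (fun _ => combinations _ _) => apply: computable_combinations
  | |- computable (fun _ => multiples _ _ _) => apply: computable_multiples
  | |- computable (fun _ => degree_frac _) => apply: computable_degree_frac
  | _ => computable_poly
  end.
Ltac computable_hook ::= computable_frac.

Lemma computable_mx_mul (E : Type) (EE : Enc E) (m n : E -> nat) (X Y : E -> raw_mx) :
  computable m -> computable n -> computable X -> computable Y ->
  computable (fun e => mx_mul (m e) (n e) (X e) (Y e)).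
Proof. by move=> Hm Hn HX HY; rewrite /mx_mul; computability. Qed.

Lemma computable_in_span (E : Type) (EE : Enc E) (p m k n : E -> nat)
    (gs : E -> seq raw_poly) (f : E -> raw_poly) :
  computable p -> computable m -> computable k -> computable n -> computable gs ->
  computable f -> computable (fun e => in_span (p e) (m e) (k e) (n e) (gs e) (f e)).
Proof. by move=> Hp Hm Hk Hn Hgs Hf; rewrite /in_span; computability. Qed.

Section ComputableSystem.
Context {E : Type} {EE : Enc E}.
Variable R : E -> raw_system.
Hypothesis HR : computable R.

Lemma computable_sys_p : computable (fun e => sys_p (R e)).
Proof. by rewrite /sys_p; computability. Qed.

Lemma computable_sys_m : computable (fun e => sys_m (R e)).
Proof. by rewrite /sys_m; computability. Qed.

Lemma computable_sys_n : computable (fun e => sys_n (R e)).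
Proof. by rewrite /sys_n; computability. Qed.

Lemma computable_sys_t : computable (fun e => sys_t (R e)).
Proof. by rewrite /sys_t; computability. Qed.

Lemma computable_sys_s : computable (fun e => sys_s (R e)).
Proof. by rewrite /sys_s; computability. Qed.

Lemma computable_sys_r : computable (fun e => sys_r (R e)).
Proof. by rewrite /sys_r; computability. Qed.

Lemma computable_sys_relations : computable (fun e => sys_relations (R e)).
Proof. by rewrite /sys_relations; computability. Qed.

Variables i j k : E -> nat.
Hypotheses (Hi : computable i) (Hj : computable j) (Hk : computable k).

Lemma computable_sys_P : computable (fun e => sys_P (R e) (i e) (j e)).
Proof. by rewrite /sys_P; computability. Qed.

Lemma computable_sys_b : computable (fun e => sys_b (R e) (i e) (j e) (k e)).
Proof. by rewrite /sys_b; computability. Qed.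

Lemma computable_sys_a : computable (fun e => sys_a (R e) (i e) (j e) (k e)).
Proof. by rewrite /sys_a; computability. Qed.

End ComputableSystem.

Ltac computable_system :=
  lazymatch goal with
  | |- computable (fun _ => sys_p _) => apply: computable_sys_p
  | |- computable (fun _ => sys_m _) => apply: computable_sys_m
  | |- computable (fun _ => sys_n _) => apply: computable_sys_n
  | |- computable (fun _ => sys_t _) => apply: computable_sys_t
  | |- computable (fun _ => sys_s _) => apply: computable_sys_s
  | |- computable (fun _ => sys_r _) => apply: computable_sys_r
  | |- computable (fun _ => sys_relations _) => apply: computable_sys_relations
  | |- computable (fun _ => sys_P _ _ _) => apply: computable_sys_P
  | |- computable (fun _ => sys_b _ _ _ _) => apply: computable_sys_b
  | |- computable (fun _ => sys_a _ _ _ _) => apply: computable_sys_a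
  | |- computable (fun _ => mx_mul _ _ _ _) => apply: computable_mx_mul
  | |- computable (fun _ => in_span _ _ _ _ _ _) => apply: computable_in_span
  | _ => computable_frac
  end.
Ltac computable_hook ::= computable_system.

Lemma computable_numerators (E : Type) (EE : Enc E) (R : E -> raw_system)
    (u : E -> seq (seq nat)) :
  computable R -> computable u -> computable (fun e => numerators (R e) (u e)).
Proof.
move=> HR Hu; rewrite /numerators /equation_value /P_value /term_value /monomial_value
  /word_value /mx_pow; computability.
Qed.

Lemma computable_sys_fracs (E : Type) (EE : Enc E) (R : E -> raw_system) :
  computable R -> computable (fun e => sys_fracs (R e)).
Proof. by move=> HR; rewrite /sys_fracs /mx_fracs; computability. Qed.

Lemma computable_test_length (E : Type) (EE : Enc E) (R : E -> raw_system) :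
  computable R -> computable (fun e => test_length (R e)).
Proof.
move=> HR; have Hb : computable (fun e => sys_state_bound (R e)).
  have HA := computable_sys_fracs HR.
  have Hd : computable (fun e => sys_degree (R e)) by rewrite /sys_degree; computability.
  have Hf : computable (fun e => form_degree (R e)) by rewrite /form_degree; computability.
  by rewrite /sys_state_bound /state_bound /degree_bound; computability.
by rewrite /test_length; computability.
Qed.

Ltac computable_hook ::=
  lazymatch goal with
  | |- computable (fun _ => numerators _ _) => apply: computable_numerators
  | |- computable (fun _ => test_length _) => apply: computable_test_length
  | _ => computable_system
  end.

Lemma computable_stage_settled :
  computable (fun z : raw_system * nat => stage_settled z.1 z.2).
Proof. by rewrite /stage_settled /settled; computability. Qed.

Lemma computable_stage_automaton :
  computable (fun z : raw_system * nat => stage_automaton z.1 z.2).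
Proof.
rewrite /stage_automaton; apply: computable_test_automaton; computability.
by rewrite /holds_at; computability.
Qed.

(** * Meaning of the lists *)

Section Meaning.
Local Open Scope ring_scope.
Variables (p m : nat) (F : fieldType).
Hypotheses (pF : p \in [pchar F]) (F_nat : forall x : F, exists2 k, (k < p)%N & x = k%:R).
Local Notation S := {mpoly F[m]}.

Definition mnm_of (v : seq nat) : 'X_{1..m} := [multinom nth 0%N v i | i < m].
Definition poly_of (f : raw_poly) : S := \sum_(x <- f) x.2%:R *: 'X_[mnm_of x.1].

Lemma poly_of_cat f g : poly_of (f ++ g) = poly_of f + poly_of g.
Proof. exact: big_cat. Qed.

Lemma poly_of_mul f g : poly_of (poly_mul m f g) = poly_of f * poly_of g.
Proof.
rewrite /poly_of big_allpairs_dep mulr_suml; apply: eq_bigr => x _.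
rewrite mulr_sumr; apply: eq_bigr => y _ /=.
rewrite natrM -scalerAl -scalerAr scalerA -mpolyXD; congr (_ *: 'X_[_]).
apply/mnmP => i; rewrite mnmDE !mnmE (nth_map 0%N) ?size_iota //.
by rewrite nth_iota.
Qed.

Lemma poly_of_scale c f : poly_of (poly_scale c f) = c%:R *: poly_of f.
Proof.
rewrite /poly_of big_map scaler_sumr; apply: eq_bigr => x _.
by rewrite natrM scalerA.
Qed.

Lemma poly_of_const k : poly_of [:: ([::], k)] = k%:R.
Proof.
rewrite /poly_of big_seq1 /= -[RHS]mpolyC_nat -alg_mpolyC -(mpolyX0 m F).
by congr (_ *: 'X_[_]); apply/mnmP => i; rewrite !mnmE nth_nil.
Qed.

Lemma deg_le_poly_of f : deg_le (degree_poly f) (poly_of f).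
Proof.
have FD := deg_le_filtration F m.
elim: f => [|x f IH]; first by rewrite /poly_of big_nil; exact: (filt0 FD).
rewrite /poly_of big_cons /degree_poly /=; apply: (filtD FD).
  apply: deg_leZ; apply: deg_leX; apply: leq_trans (leq_addr _ _).
  rewrite mdegE; case: x => v c /=.
  under eq_bigr do rewrite mnmE.
  elim: (m) v => [|n IHn] v; first by rewrite big_ord0.
  rewrite big_ord_recl; case: v => [|a v] /=.
    by rewrite big1 // => i _; rewrite nth_nil.
  by rewrite leq_add2l; exact: IHn.
by apply: (filtW FD (leq_addl _ _)).
Qed.

(** ** Exponents modulo X^(k+1) = X *)

Lemma reduce0 e : reduce 0 e = e.
Proof. by rewrite /reduce modn0; case: e. Qed.

Lemma reduce_le k e : (0 < k)%N -> (reduce k e <= k)%N.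
Proof. by move=> k0; rewrite /reduce; case: ifP => // _; rewrite ltn_pmod. Qed.

Lemma reduceD k a b : (0 < k)%N -> reduce k (reduce k a + b) = reduce k (a + b).
Proof.
by move=> k0; case: a => // a; rewrite /reduce /= ?addSn /= modnDml.
Qed.

Definition reduce_mnm k (u : 'X_{1..m}) : 'X_{1..m} := [multinom reduce k (u i) | i < m].
Definition reduce_poly k : S -> S := lext (fun u => 'X_[reduce_mnm k u]).

Lemma reduce_poly0 f : reduce_poly 0 f = f.
Proof.
elim/mpoly_additive_ind: f => [|f g IHf IHg|a u]; first exact: raddf0.
  by rewrite /reduce_poly raddfD /= -!/(reduce_poly 0 _) IHf IHg.
rewrite /reduce_poly linearZ /= lextX; congr (_ *: 'X_[_]).
by apply/mnmP => i; rewrite mnmE reduce0.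
Qed.

Lemma reduce_polyD k f g : reduce_poly k (f + g) = reduce_poly k f + reduce_poly k g.
Proof. exact: raddfD. Qed.

Lemma reduce_poly_sum k I (r : seq I) (G : I -> S) :
  reduce_poly k (\sum_(i <- r) G i) = \sum_(i <- r) reduce_poly k (G i).
Proof. exact: raddf_sum. Qed.

Lemma reduce_polyM k f g : (0 < k)%N ->
  reduce_poly k (reduce_poly k f * g) = reduce_poly k (f * g).
Proof.
move=> k0; elim/mpoly_additive_ind: f => [|f1 f2 IH1 IH2|a u].
- by rewrite /reduce_poly raddf0 !mul0r.
- by rewrite !reduce_polyD !mulrDl !reduce_polyD IH1 IH2.
elim/mpoly_additive_ind: g => [|g1 g2 IH1 IH2|b v].
- by rewrite !mulr0.
- by rewrite !mulrDr !reduce_polyD IH1 IH2.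
rewrite /reduce_poly [lext _ (a *: _)]linearZ /= lextX -!scalerAl -!scalerAr -!mpolyXD.
rewrite !linearZ /= !lextX; congr (_ *: (_ *: 'X_[_])).
by apply/mnmP => i; rewrite !mnmE reduceD.
Qed.

Lemma same_monomialP k u v :
  same_monomial m k u v = (reduce_mnm k (mnm_of u) == reduce_mnm k (mnm_of v)).
Proof.
apply/allP/eqP => [H|/mnmP H i].
  apply/mnmP => i; rewrite !mnmE; apply/eqP; apply: H.
  by rewrite mem_iota /=.
rewrite mem_iota => /= im; have := H (Ordinal im).
by rewrite !mnmE => ->.
Qed.

Lemma natr_eq0_pchar n : (n%:R == 0 :> F) = (n %% p == 0)%N.
Proof. by rewrite -(dvdn_pcharf pF). Qed.

Lemma is_zeroP k f : is_zero p m k f <-> reduce_poly k (poly_of f) = 0.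
Proof.
have coefE v : (reduce_poly k (poly_of f))@_v =
    (sumn [seq y.2 | y <- f & reduce_mnm k (mnm_of y.1) == v])%:R.
  rewrite /poly_of reduce_poly_sum raddf_sum /= sumnE big_map big_filter natr_sum.
  rewrite [RHS]big_mkcond; apply: eq_bigr => x _.
  rewrite /reduce_poly linearZ /= lextX mcoeffZ mcoeffX.
  by case: ifP => _; rewrite ?mulr1 ?mulr0.
have sameE x : [seq y.2 | y <- f & same_monomial m k x y.1] =
    [seq y.2 | y <- f & reduce_mnm k (mnm_of y.1) == reduce_mnm k (mnm_of x)].
  by congr map; apply: eq_filter => y; rewrite same_monomialP eq_sym.
split=> [/allP H|H].
  apply/mpolyP => v; rewrite mcoeff0 coefE; apply/eqP.
  have [/hasP[x xf /eqP <-]|/hasPn no] :=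
    boolP (has (fun y => reduce_mnm k (mnm_of y.1) == v) f).
    by rewrite natr_eq0_pchar -sameE; exact: H.
  by rewrite (eq_in_filter (a2 := pred0)) ?filter_pred0 // => y yf; apply/negbTE/no.
by apply/allP => x xf /=; rewrite sameE -natr_eq0_pchar -coefE H mcoeff0.
Qed.

(** ** Linear spans *)

Definition spanned (gs : seq raw_poly) (v : S) : Prop :=
  exists2 s, s \in combinations p gs & poly_of s = v.

Lemma spanned_nil v : spanned [::] v <-> v = 0.
Proof.
have nil0 : poly_of [::] = 0 by rewrite /poly_of big_nil.
split=> [[s]|->]; first by rewrite inE => /eqP -> <-.
by exists [::]; rewrite ?inE.
Qed.

Lemma spanned_cons g gs v :
  spanned (g :: gs) v <-> exists (a : F) v', spanned gs v' /\ v = a *: poly_of g + v'.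
Proof.
split=> [[s /allpairsP[[c s'] /= [_ s'gs ->]] <-]|[a [v' [[s sgs <-] ->]]]].
  exists c%:R, (poly_of s'); split; first by exists s'.
  by rewrite poly_of_cat poly_of_scale.
have [k kp ->] := F_nat a; exists (poly_scale k g ++ s).
  by apply/allpairsP; exists (k, s); rewrite mem_iota.
by rewrite poly_of_cat poly_of_scale.
Qed.

Lemma spanned0 gs : spanned gs 0.
Proof.
elim: gs => [|g gs IH]; first exact/spanned_nil.
by apply/spanned_cons; exists 0, 0; rewrite scale0r addr0.
Qed.

Lemma spanned_lin gs a v w : spanned gs v -> spanned gs w -> spanned gs (a *: v + w).
Proof.
elim: gs v w => [|g gs IH] v w.
  by move=> /spanned_nil -> /spanned_nil ->; apply/spanned_nil; rewrite scaler0 addr0.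
move=> /spanned_cons[b [v' [Hv ->]]] /spanned_cons[c [w' [Hw ->]]].
apply/spanned_cons; exists (a * b + c), (a *: v' + w'); split; first exact: IH.
by rewrite scalerDr scalerA scalerDl addrACA.
Qed.

Lemma spanned_mem gs g : g \in gs -> spanned gs (poly_of g).
Proof.
elim: gs => // h gs IH; rewrite inE => /orP[/eqP ->|ggs]; apply/spanned_cons.
  by exists 1, 0; split; [exact: spanned0|rewrite scale1r addr0].
by exists 0, (poly_of g); split; [exact: IH|rewrite scale0r add0r].
Qed.

Lemma spanned_sum gs I (r : seq I) (Q : pred I) (G : I -> S) :
  (forall i, Q i -> spanned gs (G i)) -> spanned gs (\sum_(i <- r | Q i) G i).
Proof.
move=> H; elim/big_ind: _ => //; first exact: spanned0.
by move=> v w Hv Hw; rewrite -[v]scale1r; exact: spanned_lin.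
Qed.

Lemma spanned_multiple E gs g (q : S) : g \in gs ->
  (forall u, u \in msupp q -> forall i, (u i < E)%N) ->
  spanned (multiples m E gs) (q * poly_of g).
Proof.
move=> ggs qE; rewrite [q]mpolyE big_seq mulr_suml.
apply: spanned_sum => u uq; rewrite -scalerAl -[_ *: _]addr0.
apply: spanned_lin; last exact: spanned0.
pose v : seq nat := [seq u i | i <- enum 'I_m].
have vE : mnm_of v = u.
  by apply/mnmP => i; rewrite mnmE (nth_map i) ?size_enum_ord // nth_ord_enum.
have -> : 'X_[u] * poly_of g = poly_of (poly_mul m [:: (v, 1%N)] g).
  by rewrite poly_of_mul {2}/poly_of big_seq1 /= scale1r vE.
apply: spanned_mem; apply/allpairsP; exists (v, g); split=> //=.
rewrite mem_box size_map size_enum_ord eqxx /=.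
by apply/allP => _ /mapP[i _ ->]; exact: qE.
Qed.

(** ** Correctness of the membership search *)

Variables (K : fieldType) (toK : {rmorphism F -> K}) (c : 'I_m -> K) (gs : seq raw_poly).
Local Notation ev := (mmap toK c).
Hypothesis gs_ideal : forall f : S, ev f = 0 <-> in_ideal (map poly_of gs) f.

Lemma relation_ev g : g \in gs -> ev (poly_of g) = 0.
Proof.
move=> ggs; apply/gs_ideal; pose i := index g gs; exists (fun j => (j == i)%:R).
have ilt : (i < size (map poly_of gs))%N by rewrite size_map index_mem.
rewrite (bigD1 (Ordinal ilt)) //= eqxx mul1r big1 ?addr0 => [|j ji].
  by rewrite (nth_map g) ?index_mem // nth_index.
by have := ji; rewrite -(inj_eq val_inj) /= => /negbTE ->; rewrite mul0r.
Qed.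

Lemma multiples_kernel (R : fieldType) (toR : {rmorphism F -> R}) (x : 'I_m -> R) E g :
  (forall h, ev h = 0 -> mmap toR x h = 0) ->
  g \in multiples m E gs -> mmap toR x (poly_of g) = 0.
Proof.
move=> H /allpairsP[[e g'] /= [_ g'gs ->]].
by rewrite poly_of_mul rmorphM /= [X in _ * X]H ?mulr0 // relation_ev.
Qed.

Lemma spanned_mmap (R : fieldType) (toR : {rmorphism F -> R}) (x : 'I_m -> R) E v :
  (forall h, ev h = 0 -> mmap toR x h = 0) ->
  spanned (multiples m E gs) v -> mmap toR x v = 0.
Proof.
move=> H; have := fun g => @multiples_kernel R toR x E g H.
elim: (multiples m E gs) v => [|g hs IH] v Hg; first by move/spanned_nil ->; rewrite mmap0.
move/spanned_cons => [a [v' [Hv ->]]]; rewrite mmapD mmapZ Hg ?mem_head // mulr0 add0r.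
by apply: IH Hv => g' g'gs; apply: Hg; rewrite inE g'gs orbT.
Qed.

Lemma in_spanP k E f :
  in_span p m k E gs f <->
  exists2 v, spanned (multiples m E gs) v & reduce_poly k (poly_of f + v) = 0.
Proof.
split=> [/hasP[s sgs /is_zeroP]|[v [s sgs <-]]]; rewrite -?poly_of_cat => H.
  by exists (poly_of s) => //; [exists s | rewrite -poly_of_cat].
by apply/hasP; exists s => //; exact/is_zeroP.
Qed.

Lemma in_span_sound N f : in_span p m 0 N gs f -> ev (poly_of f) = 0.
Proof.
move=> /in_spanP[v vgs]; rewrite reduce_poly0 => /(congr1 ev).
by rewrite mmapD (spanned_mmap _ vgs) // addr0 mmap0.
Qed.

Lemma in_span_complete f : ev (poly_of f) = 0 ->
  exists N0, forall N, (N0 <= N)%N -> in_span p m 0 N gs f.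
Proof.
move=> /gs_ideal[q fE]; rewrite size_map in fE.
exists (\sum_(j < size gs) msize (q j)) => N HN; apply/in_spanP.
exists (- poly_of f); last by rewrite subrr reduce_poly0.
rewrite fE -scaleN1r -[_ *: _]addr0; apply: spanned_lin; last exact: spanned0.
apply: spanned_sum => j _; rewrite (nth_map [::]) //.
apply: spanned_multiple; first exact: mem_nth.
move=> u uq i; apply: leq_trans HN; rewrite (bigD1 j) //= ltn_addr //.
by apply: leq_ltn_trans (msize_mdeg_lt uq); rewrite mdegE (bigD1 i) //= leq_addr.
Qed.

Lemma msupp_reduce_poly k f u i : (0 < k)%N -> u \in msupp (reduce_poly k f) -> (u i < k.+1)%N.
Proof.
move=> k0; rewrite /reduce_poly /lext => /msupp_sum_le/flattenP[s /mapP[v _ ->]].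
by move/msuppZ_le; rewrite msuppX inE => /eqP ->; rewrite mnmE ltnS reduce_le.
Qed.

(** If f = sum_j q_j g_j then f and sum_j q'_j g_j agree modulo X_i^(p^N) = X_i,
    where q'_j is the reduction of q_j. *)
Lemma in_span_reduced_complete N f : (0 < N)%N -> ev (poly_of f) = 0 ->
  in_span p m (p ^ N).-1 (p ^ N) gs f.
Proof.
move=> N0; set k := (p ^ N).-1.
have p1 : (1 < p)%N by exact: prime_gt1 (pcharf_prime pF).
have pN : (1 < p ^ N)%N by apply: leq_trans (leq_pexp2l (ltnW p1) N0); rewrite expn1.
have kE : (p ^ N = k.+1)%N by rewrite /k prednK // ltnW.
have k0 : (0 < k)%N by rewrite -ltnS -kE.
move=> /gs_ideal[q fE]; rewrite size_map in fE; apply/in_spanP; rewrite kE.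
exists (- \sum_(j < size gs) reduce_poly k (q j) * (map poly_of gs)`_j).
  rewrite -scaleN1r -[_ *: _]addr0; apply: spanned_lin; last exact: spanned0.
  apply: spanned_sum => j _; rewrite (nth_map [::]) //.
  apply: spanned_multiple; first exact: mem_nth.
  by move=> u uq i; exact: msupp_reduce_poly uq.
rewrite [poly_of f]fE /reduce_poly raddfB /= -/(reduce_poly k _) -/(reduce_poly k _).
rewrite !reduce_poly_sum; apply/eqP; rewrite subr_eq0; apply/eqP.
by apply: eq_bigr => j _; rewrite reduce_polyM.
Qed.

Lemma mmap_reduce_poly (R : fieldType) (toR : {rmorphism F -> R}) (x : 'I_m -> R) k f :
  (forall i, x i ^+ k.+1 = x i) -> mmap toR x (reduce_poly k f) = mmap toR x f.
Proof.
move=> xk; elim/mpoly_additive_ind: f => [|f g IHf IHg|a u].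
- by rewrite /reduce_poly raddf0.
- by rewrite reduce_polyD !mmapD IHf IHg.
rewrite /reduce_poly linearZ /= lextX !mmapZ !mmapX; congr (_ * _).
apply: eq_bigr => i _; rewrite mnmE /reduce; case: eqP => [->|/eqP] //.
rewrite -lt0n => /prednK {2}<-; move: (u i).-1 => e.
have xl l : x i ^+ (l * k).+1 = x i.
  by elim: l => // l IH; rewrite mulSn -addnS exprD IH -exprSr xk.
by rewrite [in RHS](divn_eq e k) -addSn exprD xl exprS.
Qed.

Lemma settled_correct N f : settled p m N gs f ->
  in_span p m 0 N gs f = (ev (poly_of f) == 0).
Proof.
move=> st; apply/idP/eqP => [/in_span_sound //|f0].
case/orP: st => // /hasP[N' ]; rewrite mem_iota => /andP[N'0 _] /negP[].
exact: in_span_reduced_complete.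
Qed.

End Meaning.

Section Termination.
Local Open Scope ring_scope.
Variables (p m : nat) (F : finFieldType).
Hypotheses (pF : p \in [pchar F]) (F_nat : forall x : F, exists2 k, (k < p)%N & x = k%:R).
Variables (K : fieldType) (toK : {rmorphism F -> K}) (c : 'I_m -> K) (gs : seq raw_poly).
Local Notation ev := (mmap toK c).
Hypothesis gs_ideal : forall f : {mpoly F[m]}, ev f = 0 <-> in_ideal (map (poly_of m F) gs) f.

(** Membership shows up as an explicit combination, and non-membership as
    non-membership after adding the relations X^(p^N) = X, which hold at a
    point over a finite field. *)
Lemma settled_eventually f : exists N0, forall N, (N0 <= N)%N -> settled p m N gs f.
Proof.
have [f0|f0] := eqVneq (ev (poly_of m F f)) 0.
  have [N0 HN0] := in_span_complete pF F_nat gs_ideal f0.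
  by exists N0 => N /HN0 st; rewrite /settled st.
have [Omega [toO [x [N' [N'0 xN' fx Hx]]]]] := finite_point pF f0.
exists N' => N N'N; apply/orP; right; apply/hasP; exists N'.
  by rewrite mem_iota N'0 add1n ltnS.
apply/negP => /(@in_spanP p m F pF)[v vgs] /(congr1 (mmap toO x)).
have pN : (0 < p ^ N')%N by rewrite expn_gt0 prime_gt0 ?(pcharf_prime pF).
rewrite mmap_reduce_poly ?mmap0 => [|i]; last by rewrite prednK.
by rewrite mmapD (spanned_mmap F_nat gs_ideal Hx vgs) addr0 => /eqP; rewrite (negbTE fx).
Qed.

End Termination.

(** * Fractions *)

Section FractionMeaning.
Local Open Scope ring_scope.
Variables (m : nat) (F K : fieldType) (toK : {rmorphism F -> K}) (c : 'I_m -> K).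
Local Notation val f := (mmap toK c (poly_of m F f)).

Definition frac_denotes (q : raw_frac) (v : K) : Prop := val q.2 != 0 /\ v = val q.1 / val q.2.

Lemma val_mul f g : val (poly_mul m f g) = val f * val g.
Proof. by rewrite poly_of_mul rmorphM. Qed.

Lemma val_cat f g : val (f ++ g) = val f + val g.
Proof. by rewrite poly_of_cat mmapD. Qed.

Lemma val_nat k : val [:: ([::], k)] = k%:R.
Proof. by rewrite poly_of_const rmorph_nat. Qed.

Lemma frac_denotes_nat k : frac_denotes (frac_nat k) k%:R.
Proof. by rewrite /frac_denotes !val_nat divr1 oner_eq0. Qed.

Lemma frac_denotes_mul q q' v v' :
  frac_denotes q v -> frac_denotes q' v' -> frac_denotes (frac_mul m q q') (v * v').
Proof.
move=> [q0 ->] [q0' ->]; rewrite /frac_denotes !val_mul mulf_neq0 //.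
by split=> //; field; rewrite q0 q0'.
Qed.

Lemma frac_denotes_add q q' v v' :
  frac_denotes q v -> frac_denotes q' v' -> frac_denotes (frac_add m q q') (v + v').
Proof.
move=> [q0 ->] [q0' ->]; rewrite /frac_denotes val_cat !val_mul mulf_neq0 //.
by split=> //; field; rewrite q0 q0'.
Qed.

Lemma frac_denotes_sum (T : eqType) (r : seq T) (G : T -> raw_frac) (v : T -> K) :
  (forall x, x \in r -> frac_denotes (G x) (v x)) ->
  frac_denotes (frac_sum m (map G r)) (\sum_(x <- r) v x).
Proof.
elim: r => [|x r IH] H; first by rewrite big_nil; exact: (frac_denotes_nat 0).
rewrite big_cons; apply: frac_denotes_add; first by apply: H; exact: mem_head.
by apply: IH => y yr; apply: H; rewrite inE yr orbT.
Qed.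

Lemma frac_denotes_sum_ord n (G : nat -> raw_frac) (v : 'I_n -> K) :
  (forall k : 'I_n, frac_denotes (G k) (v k)) ->
  frac_denotes (frac_sum m [seq G k | k <- iota 0 n]) (\sum_(k < n) v k).
Proof.
move=> H; rewrite -val_enum_ord -map_comp -[\sum_k _]big_enum.
by apply: frac_denotes_sum => k _; exact: H.
Qed.

Lemma frac_denotes_eq0 q v : frac_denotes q v -> (v == 0) = (val q.1 == 0).
Proof. by move=> [q0 ->]; rewrite mulf_eq0 invr_eq0 (negbTE q0) orbF. Qed.

Variable d : nat.
Definition mx_denotes (X : raw_mx) (A : 'M[K]_d.+1) : Prop :=
  forall x y : 'I_d.+1, frac_denotes (mx_entry X x y) (A x y).

Lemma mx_entry_tab (G : nat -> nat -> raw_frac) n x y : (x < n)%N -> (y < n)%N ->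
  mx_entry [seq [seq G x y | y <- iota 0 n] | x <- iota 0 n] x y = G x y.
Proof.
move=> xn yn; rewrite /mx_entry (nth_map 0%N) ?size_iota // (nth_map 0%N) ?size_iota //.
by rewrite !nth_iota.
Qed.

Lemma mx_denotes_mul X Y A B :
  mx_denotes X A -> mx_denotes Y B -> mx_denotes (mx_mul m d.+1 X Y) (A * B).
Proof.
move=> XA YB x y; rewrite mx_entry_tab // mxE.
by apply: frac_denotes_sum_ord => k; exact: frac_denotes_mul.
Qed.

Lemma mx_denotes_one : mx_denotes (mx_one d.+1) 1.
Proof.
move=> x y; rewrite mx_entry_tab // mxE -val_eqE.
by case: eqP => _; [exact: (frac_denotes_nat 1) | exact: (frac_denotes_nat 0)].
Qed.

Lemma mx_denotes_pow X A k : mx_denotes X A -> mx_denotes (mx_pow m d.+1 X k) (A ^+ k).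
Proof.
move=> XA; elim: k => [|k IH]; first exact: mx_denotes_one.
by rewrite exprS; exact: mx_denotes_mul.
Qed.

Lemma mx_denotes_foldl n (Y : nat -> raw_mx) (B : 'I_n -> 'M[K]_d.+1) X A :
  mx_denotes X A -> (forall k : 'I_n, mx_denotes (Y k) (B k)) ->
  mx_denotes (foldl (fun Z k => mx_mul m d.+1 Z (Y k)) X (iota 0 n)) (A * \prod_(k < n) B k).
Proof.
move=> XA YB; have -> : \prod_(k < n) B k = \prod_(k <- enum 'I_n) B k.
  by congr bigop; rewrite [index_enum _]unlock enumT.
rewrite -val_enum_ord.
elim: (enum _) X A XA => [|k r IH] X A XA /=; first by rewrite big_nil mulr1.
by rewrite big_cons mulrA; apply: IH; exact: mx_denotes_mul.
Qed.

End FractionMeaning.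

(** * Systems with cleared denominators *)

Section ScaledSystem.
Local Open Scope ring_scope.
Variables (p m d t s r : nat) (F : finFieldType) (pF : p \in [pchar F]).
Variables (K : fieldType) (ev : {rmorphism {mpoly F[m]} -> K}) (Sy : expsys K d t s r).
Variables (Q : 'I_s -> 'I_r -> letter p t -> {mpoly F[m]}).
Variables (B : 'I_s -> 'I_r -> 'I_t.+1 -> 'M[{mpoly F[m]}]_d.+1)
  (A : 'I_s -> 'I_r -> 'I_t -> 'M[{mpoly F[m]}]_d.+1) (D : K).
Hypotheses (D0 : D != 0)
  (evQ : forall i j (a : letter p t), ev (Q i j a) = D * (P Sy i j).@[fun k => (a k)%:R])
  (evB : forall i j k, map_mx ev (B i j k) = D *: b Sy i j k)
  (evA : forall i j k, map_mx ev (A i j k) = D *: a Sy i j k).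

(** Multiplying all constants by D multiplies every summand of an equation by
    the same power of D, whose exponent depends on n only. *)
Lemma scaled_solution u :
  word_solution Sy u <->
  [forall j, forall x, forall y,
    ev (\sum_i Q i j (last_letter pF u) * exp_term B A i j (phi u) x y) == 0].
Proof.
have pK : p \in [pchar K].
  rewrite inE (pcharf_prime pF) /=.
  have /(congr1 ev) : (p%:R : {mpoly F[m]}) = 0 by apply/pcharf0/pchar_mpoly.
  by rewrite rmorph_nat rmorph0 => ->.
(* The values of n in K are those of its last digits. *)
have natr_last k : (last_letter pF u k)%:R = (phi u k)%:R :> K.
  rewrite ffunE /= [in RHS](divn_eq (phi u k) p) natrD natrM (pcharf0 pK).
  by rewrite mulr0 add0r.
pose e := (1 + (\sum_(k < t) (phi u k + 1)))%N.
pose T i j := b Sy i j ord0 * \prod_(k < t) (a Sy i j k ^+ phi u k * b Sy i j (lift ord0 k)).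
have evT i j : map_mx ev (exp_term B A i j (phi u)) = D ^+ e *: T i j.
  rewrite /exp_term rmorphM rmorph_prod /= evB.
  under eq_bigr do rewrite rmorphM rmorphXn /= evA evB exprZn -scalerAl -scalerAr scalerA -exprSr.
  rewrite scaler_prod -scalerAl -scalerAr scalerA; congr (_ *: _).
  by rewrite prodrXr -exprS /e add1n; congr (_ ^+ _.+1); apply: eq_bigr => k _; rewrite addn1.
have evE j x y : ev (\sum_i Q i j (last_letter pF u) * exp_term B A i j (phi u) x y) =
    D ^+ e.+1 * (\sum_(i < s) (P Sy i j).@[fun k => (phi u k)%:R] *: T i j) x y.
  rewrite rmorph_sum summxE mulr_sumr; apply: eq_bigr => i _.
  rewrite rmorphM evQ (meval_eq _ natr_last).
  have -> : ev (exp_term B A i j (phi u) x y) = D ^+ e * T i j x y.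
    by have /matrixP/(_ x y) := evT i j; rewrite !mxE.
  by rewrite [in RHS]mxE exprS; ring.
have eq0 j x y : (ev (\sum_i Q i j (last_letter pF u) * exp_term B A i j (phi u) x y) == 0) =
    ((\sum_(i < s) (P Sy i j).@[fun k => (phi u k)%:R] *: T i j) x y == 0).
  by rewrite evE mulf_eq0 expf_eq0 (negbTE D0) andbF.
split=> [H|/forallP H j].
  apply/forallP => j; apply/forallP => x; apply/forallP => y.
  by rewrite eq0 /T (H j) mxE.
apply/matrixP => x y; have /forallP/(_ x)/forallP/(_ y) := H j.
by rewrite eq0 => /eqP E; rewrite mxE -[RHS]E.
Qed.

End ScaledSystem.

(** * Correctness of the search *)

Lemma eq_test_automaton (L L' : seq (seq nat) -> bool) p t l :
  (forall u, u \in words p t (2 * l).+1 -> L u = L' u) ->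
  test_automaton L p t l = test_automaton L' p t l.
Proof.
move=> LL'; rewrite /test_automaton; set W := words p t l.
have memW i : i < size W ->
    (size (nth [::] W i) <= l) && all (fun a => a \in box t p) (nth [::] W i).
  by move=> il; rewrite -mem_words mem_nth.
congr (_, (_, (_, _))); apply: eq_in_filter.
  move=> i; rewrite mem_iota => /memW/andP[sl al]; apply: LL'; rewrite mem_words al andbT.
  by apply: leq_trans sl _; lia.
move=> e; case/allpairsP=> [[i aj] /= [ii /allpairsP[[a j] /= [ai ji ->]] ->]] /=.
move: ii ji; rewrite !mem_iota /= => /memW/andP[si Ai] /memW/andP[sj Aj].
apply: eq_in_all => v; rewrite mem_words => /andP[sv Av].
rewrite !LL' //; rewrite mem_words all_cat size_cat /=.
  by rewrite Aj Av !andbT mul2n -addnn ltnW // ltnS leq_add.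
by rewrite Ai ai Av !andbT mul2n -addnn addnS ltnS leq_add.
Qed.

(** With variables for the parts, so that rewriting does not unfold them. *)
Lemma mem_cat3 (T : eqType) (x : T) (s1 s2 s3 : seq T) :
  (x \in s1 ++ s2 ++ s3) = [|| x \in s1, x \in s2 | x \in s3].
Proof. by rewrite !mem_cat. Qed.

Section RawSystem.
Local Open Scope ring_scope.
Variables (p m d t s r : nat) (F : finFieldType).
Hypotheses (pF : p \in [pchar F]) (F_expp : forall x : F, x ^+ p = x) (cardF : #|F| = p)
  (F_nat : forall x : F, exists2 k, (k < p)%N & x = k%:R).
Variables (K : fieldType) (toK : {rmorphism F -> K}) (c : 'I_m -> K).
Variables (R : raw_system) (Sy : expsys K d t s r).
Local Notation ev := (mmap toK c).
Local Notation val f := (mmap toK c (poly_of m F f)).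
Local Notation raw := (map (@raw_letter p t)).
Let FD := deg_le_filtration F m.

(** The variables of the lists stand for the constants c. *)
Record presents : Prop := Presents {
  pres_p : sys_p R = p;
  pres_m : sys_m R = m;
  pres_n : sys_n R = d.+1;
  pres_t : sys_t R = t;
  pres_s : sys_s R = s;
  pres_r : sys_r R = r;
  pres_relations : forall f, ev f = 0 <-> in_ideal (map (poly_of m F) (sys_relations R)) f;
  pres_P_den : forall (i : 'I_s) (j : 'I_r) x, x \in sys_P R i j -> val x.2.2 != 0;
  pres_P : forall (i : 'I_s) (j : 'I_r),
    P Sy i j = \sum_(x <- sys_P R i j) (val x.2.1 / val x.2.2) *: 'X_[mnm_of t x.1];
  pres_b : forall (i : 'I_s) (j : 'I_r) (k : 'I_t.+1),
    mx_denotes toK c (sys_b R i j k) (b Sy i j k);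
  pres_a : forall (i : 'I_s) (j : 'I_r) (k : 'I_t), mx_denotes toK c (sys_a R i j k) (a Sy i j k)
}.
Hypothesis H : presents.

(** ** Evaluation of the equations *)

Lemma word_value_nth (u : seq (letter p t)) (k : 'I_t) :
  nth 0%N (word_value R (raw u)) k = phi u k.
Proof.
rewrite /word_value (pres_t H) (pres_p H) (nth_map 0%N) ?size_iota // nth_iota // add0n.
suff gen n : foldl (fun n0 a => p * n0 + nth 0 a k)%N n (raw u) =
    foldl (fun n0 (x : letter p t) => p * n0 + x k)%N n u by exact: gen.
by elim: u n => //= x u IH n; rewrite nth_raw_letter IH.
Qed.

Lemma monomial_valueE (n e : seq nat) :
  monomial_value R n e = (\prod_(k < t) nth 0 n k ^ nth 0 e k)%N.
Proof.
rewrite /monomial_value (pres_t H) -(big_mkord xpredT (fun k => nth 0 n k ^ nth 0 e k)%N).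
rewrite /index_iota subn0; elim: (iota 0 t) => [|k l IH] /=; first by rewrite big_nil.
by rewrite big_cons IH.
Qed.

Lemma P_value_denotes (i : 'I_s) (j : 'I_r) (u : seq (letter p t)) :
  frac_denotes toK c (P_value R i j (word_value R (raw u)))
    (P Sy i j).@[fun k => (phi u k)%:R].
Proof.
rewrite (pres_P H) raddf_sum /= /P_value (pres_m H); apply: frac_denotes_sum => x xP.
rewrite mevalZ mevalX mulrC; apply: frac_denotes_mul; last by split=> //; exact: (pres_P_den H xP).
rewrite monomial_valueE.
have -> : \prod_(k < t) (phi u k)%:R ^+ mnm_of t x.1 k =
    (\prod_(k < t) nth 0 (word_value R (raw u)) k ^ nth 0 x.1 k)%N%:R :> K.
  rewrite natr_prod; apply: eq_bigr => k _.
  by rewrite mnmE natrX word_value_nth.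
exact: frac_denotes_nat.
Qed.

Lemma term_value_denotes (i : 'I_s) (j : 'I_r) (u : seq (letter p t)) :
  mx_denotes toK c (term_value R i j (word_value R (raw u)))
    (b Sy i j ord0 * \prod_(k < t) (a Sy i j k ^+ phi u k * b Sy i j (lift ord0 k))).
Proof.
rewrite /term_value (pres_m H) (pres_n H) (pres_t H).
apply: (mx_denotes_foldl (Y := fun k => mx_mul m d.+1
  (mx_pow m d.+1 (sys_a R i j k) (nth 0%N (word_value R (raw u)) k)) (sys_b R i j k.+1))).
  exact: (pres_b H _ _ ord0).
move=> k; apply: mx_denotes_mul; last exact: (pres_b H _ _ (lift ord0 k)).
by rewrite word_value_nth; apply: mx_denotes_pow; exact: (pres_a H).
Qed.

Lemma equation_value_denotes (j : 'I_r) (x y : 'I_d.+1) (u : seq (letter p t)) :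
  frac_denotes toK c (equation_value R j x y (word_value R (raw u)))
    ((\sum_(i < s) (P Sy i j).@[fun k => (phi u k)%:R] *:
      (b Sy i j ord0 * \prod_(k < t) (a Sy i j k ^+ phi u k * b Sy i j (lift ord0 k)))) x y).
Proof.
rewrite summxE /equation_value (pres_s H) (pres_m H); apply: frac_denotes_sum_ord => i.
rewrite mxE; apply: frac_denotes_mul; first exact: P_value_denotes.
exact: term_value_denotes.
Qed.

Definition true_on (u : seq (seq nat)) : bool := all (fun f => val f == 0) (numerators R u).

Lemma true_onP (u : seq (letter p t)) : true_on (raw u) <-> word_solution Sy u.
Proof.
split=> [/allP T j|T].
  apply/matrixP => x y; apply/eqP.
  rewrite mxE (frac_denotes_eq0 (equation_value_denotes j x y u)); apply: T.
  rewrite /numerators (pres_r H) (pres_n H).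
  apply/mapP; exists ((j : nat, x : nat), y : nat) => //.
  apply/allpairsP; exists ((j : nat, x : nat), y : nat); split=> //; last by rewrite mem_iota /=.
  by apply/allpairsP; exists (j : nat, x : nat); split=> //; rewrite mem_iota /=.
rewrite /true_on /numerators (pres_r H) (pres_n H).
apply/allP => f /mapP[jxy /allpairsP[[jx y] [/allpairsP[[j x] [ji xi ->]] yi ->]] ->].
move: ji xi yi; rewrite !mem_iota /= => jr xd yd.
rewrite -(frac_denotes_eq0 (equation_value_denotes (Ordinal jr) (Ordinal xd) (Ordinal yd) u)).
by rewrite (T (Ordinal jr)) mxE.
Qed.

(** ** Clearing denominators *)

Local Notation fracs := (sys_fracs R).

Lemma mem_mx_fracs X (x y : 'I_d.+1) : mx_entry X x y \in mx_fracs R X.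
Proof.
apply/mapP; exists (x : nat, y : nat) => //; apply/allpairsP.
by exists (x : nat, y : nat); rewrite (pres_n H) !mem_iota /=.
Qed.

Lemma mem_sys_fracs (i : 'I_s) (j : 'I_r) q :
  [\/ q \in [seq x.2 | x <- sys_P R i j],
      exists2 k : 'I_t.+1, true & q \in mx_fracs R (sys_b R i j k) |
      exists2 k : 'I_t, true & q \in mx_fracs R (sys_a R i j k)] ->
  q \in fracs.
Proof.
move=> qH; apply/flattenP.
exists ([seq x.2 | x <- sys_P R i j] ++
        flatten [seq mx_fracs R (sys_b R i j k) | k <- iota 0 (sys_t R).+1] ++
        flatten [seq mx_fracs R (sys_a R i j k) | k <- iota 0 (sys_t R)]).
  apply/mapP; exists (i : nat, j : nat) => //; apply/allpairsP.
  by exists (i : nat, j : nat); rewrite (pres_s H) (pres_r H) !mem_iota /=.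
rewrite mem_cat3 (pres_t H); case: qH => [->//|[k _ qk]|[k _ qk]].
  apply/orP; right; apply/orP; left; apply/flattenP.
  exists (mx_fracs R (sys_b R i j k)) => //.
  by apply/mapP; exists (k : nat); rewrite ?mem_iota ?add0n ?ltn_ord.
apply/orP; right; apply/orP; right; apply/flattenP.
exists (mx_fracs R (sys_a R i j k)) => //.
by apply/mapP; exists (k : nat); rewrite ?mem_iota ?add0n ?ltn_ord.
Qed.

Lemma sys_fracs_den q : q \in fracs -> val q.2 != 0.
Proof.
have mxden X (A : 'M[K]_d.+1) : mx_denotes toK c X A -> q \in mx_fracs R X -> val q.2 != 0.
  move=> XA /mapP[xy /allpairsP[[x y] [xi yi ->]] ->].
  move: xi yi; rewrite (pres_n H) !mem_iota /= => xd yd.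
  by have [] := XA (Ordinal xd) (Ordinal yd).
case/flattenP => l /mapP[ij /allpairsP[[i j] [ii ji ->]] ->].
move: ii ji; rewrite (pres_s H) (pres_r H) !mem_iota /(_, _).1 /(_, _).2 => is_ jr.
rewrite mem_cat3 (pres_t H).
case/or3P=> [/mapP[x xP ->]|/flattenP[l' /mapP[k ki ->]]|/flattenP[l' /mapP[k ki ->]]].
- exact: (@pres_P_den H (Ordinal is_) (Ordinal jr) x).
- move: ki; rewrite mem_iota /= => kt.
  exact: mxden (pres_b H (Ordinal is_) (Ordinal jr) (Ordinal kt)).
- move: ki; rewrite mem_iota /= => kt.
  exact: mxden (pres_a H (Ordinal is_) (Ordinal jr) (Ordinal kt)).
Qed.

(** The numerator of q over the product of all denominators. *)
Definition clear (q : raw_frac) : {mpoly F[m]} :=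
  poly_of m F q.1 * \prod_(q' <- rem q fracs) poly_of m F q'.2.
Definition common_den : K := \prod_(q <- fracs) val q.2.

Lemma common_den_neq0 : common_den != 0.
Proof. by rewrite prodf_seq_neq0; apply/allP => q /sys_fracs_den. Qed.

Lemma clear_ev q : q \in fracs -> ev (clear q) = common_den * (val q.1 / val q.2).
Proof.
move=> qf; have -> : common_den = val q.2 * \prod_(q' <- rem q fracs) val q'.2 by exact: big_rem.
rewrite /clear rmorphM rmorph_prod /=.
by field; exact: sys_fracs_den.
Qed.

Lemma clear_deg q : q \in fracs -> deg_le (sys_degree R) (clear q).
Proof.
move=> qf; have -> : sys_degree R = (\sum_(q' <- fracs) degree_frac q')%N.
  by rewrite /sys_degree sumnE big_map.
rewrite (big_rem q) //= /clear /degree_frac -addnA.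
apply: (filtM FD); first exact: deg_le_poly_of.
apply: (filtW FD (leq_addl _ _)).
apply: (filtW FD _ (filt_prod FD _ (fun q' => deg_le_poly_of m F q'.2))).
by apply: leq_sum => q' _; exact: leq_addl.
Qed.

Definition clear_P i j (a : letter p t) : {mpoly F[m]} :=
  \sum_(x <- sys_P R i j) (\prod_(k < t) (a k ^ nth 0 x.1 k))%N%:R *: clear x.2.
Definition clear_b (i : 'I_s) (j : 'I_r) (k : 'I_t.+1) : 'M[{mpoly F[m]}]_d.+1 :=
  \matrix_(x, y) clear (mx_entry (sys_b R i j k) x y).
Definition clear_a (i : 'I_s) (j : 'I_r) (k : 'I_t) : 'M[{mpoly F[m]}]_d.+1 :=
  \matrix_(x, y) clear (mx_entry (sys_a R i j k) x y).

Lemma clear_P_deg (i : 'I_s) (j : 'I_r) a : deg_le (sys_degree R) (clear_P i j a).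
Proof.
rewrite /clear_P big_seq; apply: (filt_sum FD) => x xP; apply: deg_leZ.
by apply: clear_deg; apply: (mem_sys_fracs (i := i) (j := j)); constructor 1; exact: map_f.
Qed.

Lemma b_mem_fracs (i : 'I_s) (j : 'I_r) (k : 'I_t.+1) (x y : 'I_d.+1) :
  mx_entry (sys_b R i j k) x y \in fracs.
Proof.
by apply: (mem_sys_fracs (i := i) (j := j)); constructor 2; exists k => //; exact: mem_mx_fracs.
Qed.

Lemma a_mem_fracs (i : 'I_s) (j : 'I_r) (k : 'I_t) (x y : 'I_d.+1) :
  mx_entry (sys_a R i j k) x y \in fracs.
Proof.
by apply: (mem_sys_fracs (i := i) (j := j)); constructor 3; exists k => //; exact: mem_mx_fracs.
Qed.

Lemma clear_P_ev (i : 'I_s) (j : 'I_r) (a : letter p t) :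
  ev (clear_P i j a) = common_den * (P Sy i j).@[fun k => (a k)%:R].
Proof.
rewrite (pres_P H) !raddf_sum /= mulr_sumr big_seq [RHS]big_seq.
apply: eq_bigr => x xP; rewrite mmapZ clear_ev; last first.
  by apply: (mem_sys_fracs (i := i) (j := j)); constructor 1; exact: map_f.
rewrite mevalZ mevalX rmorph_nat natr_prod mulrC -!mulrA; congr (_ * (_ * (_ * _))).
by apply: eq_bigr => k _; rewrite natrX mnmE.
Qed.

Lemma clear_b_ev i j k : map_mx ev (clear_b i j k) = common_den *: b Sy i j k.
Proof.
apply/matrixP => x y; rewrite !mxE clear_ev ?b_mem_fracs //.
by have [_ <-] := pres_b H i j k x y.
Qed.

Lemma clear_a_ev i j k : map_mx ev (clear_a i j k) = common_den *: a Sy i j k.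
Proof.
apply/matrixP => x y; rewrite !mxE clear_ev ?a_mem_fracs //.
by have [_ <-] := pres_a H i j k x y.
Qed.

(** ** Bound on the form *)

(** The rows X^e g, for e below p and g a generator, suffice, which bounds the
    degree of the form. *)
Lemma relation_form : exists w : {ffun 'I_m -> 'I_p} -> {mpoly F[m]},
  root_form_of_kernel ev w /\ forall e, deg_le (form_degree R) (w e).
Proof.
pose gs := map (poly_of m F) (sys_relations R).
pose Hg (h : {mpoly F[m]}) := exists (e : {ffun 'I_m -> 'I_p}) g,
  g \in sys_relations R /\ h = 'X_[digit_mnm e] * poly_of m F g.
have Hg0 h : Hg h -> ev h = 0.
  move=> [e [g [gR ->]]]; rewrite rmorphM /= [X in _ * X](relation_ev (pres_relations H)) //.
  by rewrite mulr0.
have [w [w0 wH wd]] := root_form_exists pF F_expp Hg0.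
exists w; split.
  apply: (root_form_of_ideal pF F_expp w0 (pres_relations H)) => j e.
  have [jlt|jge] := ltnP j (size gs); last first.
    by rewrite nth_default // mulr0 root_form0 rmorph0.
  rewrite size_map in jlt; rewrite (nth_map [::]) //; apply: wH.
  by exists e, (nth [::] (sys_relations R) j); split=> //; exact: mem_nth.
move=> e; rewrite /form_degree (pres_p H) (pres_m H); apply: wd => h [e' [g [gR ->]]].
apply: (filtM FD); first exact: deg_le_digit.
apply: (filtW FD _ (deg_le_poly_of m F g)).
by rewrite sumnE big_map (big_rem g) //= leq_addr.
Qed.

Lemma true_on_states : exists (X : finType) (x0 : X) (step : X -> letter p t -> X)
    (accept : X -> bool),
  (#|X| <= sys_state_bound R)%N /\
  forall u : seq (letter p t), true_on (raw u) = accept (foldl step x0 u).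
Proof.
have [w [w_ker w_deg]] := relation_form.
have b_deg i j k x y : deg_le (sys_degree R) (clear_b i j k x y).
  by rewrite mxE; apply: clear_deg; exact: b_mem_fracs.
have a_deg i j k x y : deg_le (sys_degree R) (clear_a i j k x y).
  by rewrite mxE; apply: clear_deg; exact: a_mem_fracs.
have [X [x0 [step [accept [cardX HX]]]]] :=
  polynomial_system_states pF F_expp cardF w_ker w_deg clear_P_deg b_deg a_deg.
exists X, x0, step, accept; split.
  by rewrite /sys_state_bound (pres_p H) (pres_m H) (pres_n H) (pres_t H) (pres_s H) (pres_r H).
move=> u; rewrite HX; apply/idP/idP => [/true_onP|T].
  by move/(scaled_solution pF common_den_neq0 clear_P_ev clear_b_ev clear_a_ev).
by apply/true_onP; apply/(scaled_solution pF common_den_neq0 clear_P_ev clear_b_ev clear_a_ev).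
Qed.

(** ** The two halves of correctness *)

Lemma stage_settled_exists : exists N, stage_settled R N.
Proof.
rewrite /stage_settled (pres_p H) (pres_m H).
have all_N (T : eqType) (Q : nat -> T -> bool) (l : seq T) :
    (forall x, exists N0, forall N, (N0 <= N)%N -> Q N x) ->
    exists N0, forall N, (N0 <= N)%N -> all (Q N) l.
  move=> HQ; elim: l => [|x l [N1 H1]]; first by exists 0%N.
  have [N2 H2] := HQ x; exists (maxn N1 N2) => N; rewrite geq_max => /andP[n1 n2].
  by rewrite /= H1 // H2.
have [N0 HN0] := all_N _ (fun N u => all (settled p m N (sys_relations R)) (numerators R u))
  (words p (sys_t R) (2 * test_length R).+1)
  (fun u => all_N _ _ (numerators R u) (settled_eventually pF F_nat (pres_relations H))).
by exists N0; exact: HN0.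
Qed.

Lemma stage_automaton_correct N : stage_settled R N ->
  exists M : automaton (letter p t),
    enc_automaton M = enc (stage_automaton R N) /\ recognizes M (word_solution Sy).
Proof.
move=> st; have [X [x0 [step [accept [cardX HX]]]]] := true_on_states.
have l_big : (#|X| * #|X| <= test_length R)%N by exact: leq_mul.
have p_gt0 := prime_gt0 (pcharf_prime pF).
have [M [encM HM]] := test_automaton_recognizes p_gt0 HX l_big.
exists M; split; last by move=> u; rewrite -true_onP; exact: HM.
rewrite encM /stage_automaton (pres_p H) (pres_t H); congr enc.
apply: eq_test_automaton => u uW; rewrite /true_on /holds_at (pres_p H) (pres_m H).
apply: eq_in_all => f fn; apply/esym/(settled_correct pF F_nat (pres_relations H)).
move: st; rewrite /stage_settled (pres_p H) (pres_m H) (pres_t H).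
by move=> /allP/(_ u uW)/allP/(_ f fn).
Qed.

End RawSystem.

(** * The prime field *)

Section PrimeField.
Local Open Scope ring_scope.
Variables (p : nat) (K : fieldType) (pK : p \in [pchar K]).

Let p_pr : prime p.
Proof. exact: pcharf_prime pK. Qed.

Definition Fp_embed (x : 'F_p) : K := (x : nat)%:R.

Lemma natr_modp n : (n %% p)%N%:R = n%:R :> K.
Proof. by rewrite [in RHS](divn_eq n p) natrD natrM (pcharf0 pK) mulr0 add0r. Qed.

Lemma Fp_embed_additive : {morph Fp_embed : x y / x - y}.
Proof.
have embD x y : Fp_embed (x + y) = Fp_embed x + Fp_embed y.
  rewrite /Fp_embed -natrD -[RHS]natr_modp; congr (_%:R).
  by congr (_ %% _)%N; exact: Fp_cast.
by move=> x y; apply: (addIr (Fp_embed y)); rewrite -embD !subrK.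
Qed.

Lemma Fp_embed_multiplicative : monoid_morphism Fp_embed.
Proof.
split=> [|x y]; rewrite /Fp_embed.
  by rewrite -[RHS]mulr1n -[RHS]natr_modp; congr (_%:R); congr (_ %% _)%N; exact: Fp_cast.
by rewrite -natrM -[RHS]natr_modp; congr (_%:R); congr (_ %% _)%N; exact: Fp_cast.
Qed.

HB.instance Definition _ := GRing.isZmodMorphism.Build 'F_p K Fp_embed Fp_embed_additive.
HB.instance Definition _ := GRing.isMonoidMorphism.Build 'F_p K Fp_embed Fp_embed_multiplicative.

Lemma Fp_nat (x : 'F_p) : exists2 k, (k < p)%N & x = k%:R.
Proof. by exists (x : nat); rewrite ?natr_Zp // -[X in (_ < X)%N](Fp_cast p_pr). Qed.

Definition Fp_rmorphism : {rmorphism 'F_p -> K} := Fp_embed.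

End PrimeField.

(** * Reading a description *)

Section Describe.
Local Open Scope ring_scope.
Variables (p m d t s r : nat) (D : sysdesc p m d t s r).

Definition list_mnm n (u : 'X_{1..n}) : seq nat := [seq u i | i <- enum 'I_n].
Definition list_mpoly (f : {mpoly 'F_p[m]}) : raw_poly :=
  [seq (list_mnm u, (f@_u : nat)) | u <- msupp f].
Definition list_frac (q : Defs.frac p m) : raw_frac := (list_mpoly q.1, list_mpoly q.2).
Definition list_mx n (A : 'M[Defs.frac p m]_n) : raw_mx :=
  [seq [seq list_frac (A x y) | y <- enum 'I_n] | x <- enum 'I_n].

Definition list_sysdesc : raw_system :=
  ([:: p; m; d; t; s; r],
   ([seq list_mpoly f | f <- relations D],
    ([seq [seq [seq (list_mnm u.1, list_frac u.2) | u <- Pdesc D i j]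
          | j <- enum 'I_r] | i <- enum 'I_s],
     ([seq [seq [seq list_mx (bdesc D i j k) | k <- enum 'I_t.+1]
           | j <- enum 'I_r] | i <- enum 'I_s],
      [seq [seq [seq list_mx (adesc D i j k) | k <- enum 'I_t]
           | j <- enum 'I_r] | i <- enum 'I_s])))).

Lemma enc_seq_list (T A : Type) (EA : Enc A) (e : T -> tree) (g : T -> A) (l : seq T) :
  (forall x, e x = enc (g x)) -> enc_seq e l = enc (map g l).
Proof. by move=> eg; elim: l => //= x l ->; rewrite eg. Qed.

Lemma enc_fun_list (T A : Type) (EA : Enc A) n (e : T -> tree) (g : T -> A) (f : 'I_n -> T) :
  (forall x, e x = enc (g x)) -> enc_fun e f = enc [seq g (f i) | i <- enum 'I_n].
Proof. by move=> eg; rewrite /enc_fun (enc_seq_list _ eg) -map_comp. Qed.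

Lemma enc_mnm_list n (u : 'X_{1..n}) : enc_monom u = enc (list_mnm u).
Proof. exact: (enc_fun_list (g := fun x => x)). Qed.

Lemma enc_mpoly_list (f : {mpoly 'F_p[m]}) : enc_mpoly f = enc (list_mpoly f).
Proof. by apply: enc_seq_list => u; rewrite enc_mnm_list. Qed.

Lemma enc_frac_list (q : Defs.frac p m) : enc_frac q = enc (list_frac q).
Proof. by rewrite /enc_frac !enc_mpoly_list. Qed.

Lemma enc_mx_list n (A : 'M[Defs.frac p m]_n) : enc_mx A = enc (list_mx A).
Proof.
rewrite /enc_mx (enc_fun_list (g := fun f => [seq list_frac (f i) | i <- enum 'I_n])) // => f.
by apply: enc_fun_list => q; exact: enc_frac_list.
Qed.

Lemma enc_sysdesc_list : enc_sysdesc D = enc list_sysdesc.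
Proof.
rewrite /enc_sysdesc; congr (Node _ (Node _ (Node _ (Node _ _)))).
- by apply: enc_seq_list => f; exact: enc_mpoly_list.
- apply: (enc_fun_list (g := fun f => [seq [seq (list_mnm u.1, list_frac u.2) | u <- f j]
    | j <- enum 'I_r])) => f.
  apply: (enc_fun_list (g := fun l => [seq (list_mnm u.1, list_frac u.2) | u <- l])) => l.
  by apply: enc_seq_list => u; rewrite enc_mnm_list enc_frac_list.
- apply: (enc_fun_list (g := fun f => [seq [seq list_mx (f j k) | k <- enum 'I_t.+1]
    | j <- enum 'I_r])) => f.
  apply: (enc_fun_list (g := fun f => [seq list_mx (f k) | k <- enum 'I_t.+1])) => g.
  by apply: enc_fun_list => A; exact: enc_mx_list.
- apply: (enc_fun_list (g := fun f => [seq [seq list_mx (f j k) | k <- enum 'I_t]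
    | j <- enum 'I_r])) => f.
  apply: (enc_fun_list (g := fun f => [seq list_mx (f k) | k <- enum 'I_t])) => g.
  by apply: enc_fun_list => A; exact: enc_mx_list.
Qed.

Lemma nth_enum_map (T : Type) (x0 : T) n (G : 'I_n -> T) (i : 'I_n) :
  nth x0 [seq G i | i <- enum 'I_n] i = G i.
Proof. by rewrite (nth_map i) ?size_enum_ord // nth_ord_enum. Qed.

Lemma mnm_of_list n (u : 'X_{1..n}) : mnm_of n (list_mnm u) = u.
Proof. by apply/mnmP => i; rewrite mnmE nth_enum_map. Qed.

Lemma poly_of_list (f : {mpoly 'F_p[m]}) : poly_of m 'F_p (list_mpoly f) = f.
Proof.
rewrite /poly_of big_map [RHS]mpolyE; apply: eq_bigr => u _ /=.
by rewrite mnm_of_list natr_Zp.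
Qed.

Variables (K : fieldType) (pK : p \in [pchar K]) (c : 'I_m -> K) (Sy : expsys K d t s r).
Hypothesis D_Sy : describes c D Sy.

Lemma frac_denotes_list q v :
  denotes c q v -> frac_denotes (Fp_rmorphism pK) c (list_frac q) v.
Proof. by rewrite /frac_denotes /list_frac /= !poly_of_list. Qed.

Lemma mx_denotes_list (A : 'M[Defs.frac p m]_d.+1) (B : 'M[K]_d.+1) :
  (forall x y, denotes c (A x y) (B x y)) ->
  mx_denotes (Fp_rmorphism pK) c (list_mx A) B.
Proof.
by move=> AB x y; rewrite /mx_entry !nth_enum_map; exact: frac_denotes_list.
Qed.

(** Evaluation at c of a description agrees with that of its lists. *)
Lemma list_sysdesc_presents : presents p (Fp_rmorphism pK) c list_sysdesc Sy.
Proof.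
have [rel HP Hb Ha] := D_Sy.
have PE (i : 'I_s) (j : 'I_r) : sys_P list_sysdesc i j =
    [seq (list_mnm u.1, list_frac u.2) | u <- Pdesc D i j].
  by rewrite /sys_P /= !nth_enum_map.
split=> //.
- move=> f; rewrite /sys_relations /= -map_comp.
  have -> : [seq (poly_of m 'F_p \o list_mpoly) i | i <- relations D] = relations D.
    by rewrite -[RHS]map_id; apply: eq_map => g; exact: poly_of_list.
  exact: rel.
- move=> i j x; rewrite PE => /mapP[u uP ->] /=; rewrite poly_of_list.
  by have [H _] := HP i j; exact: H.
- move=> i j; rewrite PE big_map; have [_ ->] := HP i j.
  by apply: eq_bigr => u _ /=; rewrite !poly_of_list mnm_of_list.
- by move=> i j k; rewrite /sys_b /= !nth_enum_map; exact: mx_denotes_list.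
- by move=> i j k; rewrite /sys_a /= !nth_enum_map; exact: mx_denotes_list.
Qed.

End Describe.

(** * Regularity without a description *)

Section AllConstants.
Local Open Scope ring_scope.
Variables (p d t s r : nat) (K : fieldType) (pK : p \in [pchar K]) (Sy : expsys K d t s r).

Local Notation constant := (('I_s * 'I_r * letter p t) +
  ('I_s * 'I_r * 'I_t.+1 * 'I_d.+1 * 'I_d.+1) + ('I_s * 'I_r * 'I_t * 'I_d.+1 * 'I_d.+1))%type.

(** Values of P_ij at residues modulo p take the place of the coefficients of
    P_ij. *)
Definition constant_value (x : constant) : K :=
  match x with
  | inl (inl (i, j, a)) => (P Sy i j).@[fun k => (a k)%:R]
  | inl (inr (i, j, k, x, y)) => b Sy i j k x y
  | inr (i, j, k, x, y) => a Sy i j k x y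
  end.

(** One variable for each constant, so that no denominators occur. *)
Lemma word_solution_regular : regular (@word_solution p K d t s r Sy).
Proof.
have p_pr := pcharf_prime pK; pose F := 'F_p; have pF : p \in [pchar F] := pchar_Fp p_pr.
pose m := #|{: constant}|.
pose c (i : 'I_m) : K := constant_value (enum_val i).
pose ev : {rmorphism {mpoly F[m]} -> K} := mmap (Fp_rmorphism pK) c.
pose var (x : constant) : {mpoly F[m]} := 'X_(enum_rank x).
have ev_var x : ev (var x) = constant_value x.
  by apply: etrans (mmapX _ _ _) _; apply: etrans (mmap1U _ _) _; rewrite /c enum_rankK.
have F_expp (x : F) : x ^+ p = x := Fp_expp x p_pr.
have cardF : #|F| = p := card_Fp p_pr.
pose Q i j a := var (inl (inl (i, j, a))).
pose B i j k : 'M_d.+1 := \matrix_(x, y) var (inl (inr (i, j, k, x, y))).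
pose A i j k : 'M_d.+1 := \matrix_(x, y) var (inr (i, j, k, x, y)).
have var_deg x : deg_le 1 (var x) by apply: deg_leX; rewrite mdeg1.
have Q_deg i j (a : letter p t) : deg_le 1 (Q i j a) by exact: var_deg.
have B_deg i j k x y : deg_le 1 (B i j k x y) by rewrite mxE.
have A_deg i j k x y : deg_le 1 (A i j k x y) by rewrite mxE.
have [w [w0 w_ker _]] := root_form_exists pF F_expp (ev := ev)
  (H := fun f => ev f = 0) (fun f H => H).
have w_deg e : deg_le (\max_e msize (w e)) (w e).
  by rewrite /deg_le leqW // (leq_bigmax e).
have [X [x0 [step [accept [_ HX]]]]] :=
  polynomial_system_states pF F_expp cardF (conj w0 w_ker) w_deg Q_deg B_deg A_deg.
have evQ i j (a : letter p t) : ev (Q i j a) = 1 * (P Sy i j).@[fun k => (a k)%:R].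
  by rewrite ev_var mul1r.
have evB i j k : map_mx ev (B i j k) = 1 *: b Sy i j k.
  by apply/matrixP => x y; rewrite !mxE ev_var mul1r.
have evA i j k : map_mx ev (A i j k) = 1 *: a Sy i j k.
  by apply/matrixP => x y; rewrite !mxE ev_var mul1r.
have sol := scaled_solution pF (oner_neq0 K) evQ evB evA.
have p_gt0 := prime_gt0 p_pr.
pose L (u : seq (seq nat)) := accept (foldl step x0 (map (letter_of_raw t p_gt0) u)).
have rawK : cancel (@raw_letter p t) (letter_of_raw t p_gt0).
  by move=> l; apply: raw_letter_inj; rewrite letter_of_rawK // raw_letter_box.
have LE u : L (map (@raw_letter p t) u) = accept (foldl step x0 u).
  by rewrite /L -map_comp (eq_map (g := id)) ?map_id.
have [M [_ HM]] := test_automaton_recognizes p_gt0 LE (leqnn _).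
exists M => u; rewrite -HM LE HX; exact: sol.
Qed.

End AllConstants.

Theorem mainTheorem2 :
  (forall (p : nat) (K : fieldType) (d t s r : nat) (S : expsys K d t s r),
      p \in [pchar K]%R ->
      regular (@word_solution p K d t s r S))
  /\
  (exists algo : prog,
    forall (p : nat) (K : fieldType) (d t s r : nat) (S : expsys K d t s r)
           (m : nat) (c : 'I_m -> K) (D : sysdesc p m d t s r),
      p \in [pchar K]%R ->
      describes c D S ->
      exists M : automaton (letter p t),
        computes algo (enc_sysdesc D) (enc_automaton M) /\
        recognizes M (@word_solution p K d t s r S)).
Proof.
split=> [p K d t s r S pK|]; first exact: word_solution_regular.
have [algo Halgo] := computable_search computable_stage_settled computable_stage_automaton.
exists algo => p K d t s r S m c D pK D_S.
have p_pr := pcharf_prime pK.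
have pF := pchar_Fp p_pr.
have H := list_sysdesc_presents pK D_S.
have ex := stage_settled_exists pF (@Fp_nat p K pK) H.
have [N stN HN] := Halgo _ ex.
have [M [encM HM]] := stage_automaton_correct pF (fun x => Fp_expp x p_pr) (card_Fp p_pr)
  (@Fp_nat p K pK) H stN.
by exists M; split; rewrite // encM enc_sysdesc_list.
Qed.
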